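(* Let $\frac{p}{q}\ge 1$ be a rational number ($p,q$ relatively prime positive integers) with canonical continued fraction $[b_1,b_2,\ldots,b_{2k+1}]$, let $D$ be the canonical diagram of the rational link $L$ of slope $\frac{p}{q}$, oriented as in the context, and let $n=2k+1$. Then the Jones polynomial of $L$ is $$V_L(t)=(-1)^{w}\,t^{\frac{\sum_{i=1}^{k+1}b_{2i-1}-\left(2+\sum_{i=1}^{k}b_{2i}\right)-3w}{4}}\;\chi(G;-t,-t^{-1}),$$ where $$\chi (G;x,y)=\sum_{A\subseteq E}\ \prod_{b_i\in A}\left(\frac{x^{b_i}-1}{x-1}\right) \prod_{\alpha\in f(A)}\left(\frac{y^{\alpha}-1}{y-1}+x-1\right)$$ and $w$ is the writhe of $D$, which is given by $w=\sum_{i=1}^{n}\epsilon_i b_i$, where (the values with index greater than $n$ being omitted) (i) $\epsilon_1=\epsilon_2=1$ if $\sigma_D\in\{(1),(23),(12),(123)\}$; (ii) $\epsilon_1=-1,\ \epsilon_2=1$ if $\sigma_D\in\{(13),(132)\}$ and $b_1$ is even; (iii) $\epsilon_1=\epsilon_2=-1$ if $\sigma_D\in\{(13),(132)\}$ and $b_1$ is odd; and for $3\le i\le n$: $\epsilon_i=-\epsilon_{i-2}$ if $b_{i-1}$ is odd, $i-1$ is even and $\epsilon_{i-1}=1$; $\epsilon_i=-\epsilon_{i-2}$ if $b_{i-1}$ is odd, $i-1$ is odd and $\epsilon_{i-1}=-1$; and $\epsilon_i=\epsilon_{i-2}$ otherwise.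
   Context: Continued fractions: $[b_1,\ldots,b_n]$ denotes $b_1+\cfrac{1}{b_2+\cfrac{1}{\ddots+\cfrac{1}{b_n}}}$. Every rational $\frac pq\ge 1$ has a unique continued fraction $[b_1,\ldots,b_n]$ with $n$ odd and all $b_i\ge1$ integers; it is called the canonical continued fraction. Write $n=2k+1$. Crossing types: Draw an oriented crossing with both strands pointing upward. It is of type $L_+$ if the overcrossing strand runs from bottom right to top left (left-handed crossing), and of type $L_-$ if the overcrossing strand runs from bottom left to top right (right-handed crossing). The writhe $w$ of an oriented diagram is the number of crossings of type $L_+$ minus the number of crossings of type $L_-$. Jones polynomial: $V$ is the Jones polynomial of oriented links, normalized by $V_{\text{unknot}}=1$ and $t^{-1}V_{L_-}(t)-tV_{L_+}(t)=(t^{1/2}-t^{-1/2})V_{L_0}(t)$ with these crossing types (so the right-handed trefoil has $V=t+t^3-t^4$). Canonical diagram: $D$ is drawn on four horizontal strands, with positions numbered $1,2,3,4$ from top to bottom. From left to right it consists of $b_1$ crossings between positions $2$ and $3$, then $b_2$ crossings between positions $1$ and $2$, then $b_3$ crossings between positions $2$ and $3$, and so on alternately, ending with $b_{2k+1}$ crossings between positions $2$ and $3$. At the left end the endpoints at positions $1,2$ are joined by an arc and those at positions $3,4$ are joined by an arc, and likewise at the right end. The over/under information is such that each crossing between positions $2,3$ is of type $L_+$ when both its strands are oriented from left to right, and each crossing between positions $1,2$ is of type $L_-$ when both its strands are oriented from left to right. The diagram is alternating. The link it represents is the rational link $L$ of slope $\frac pq$. Orientation: At the left end, the strand in position $1$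 is oriented from right to left; if $D$ has two components, the strand in position $4$ at the left end, which then belongs to the other component, is also oriented from right to left. Permutation $\sigma_D\in S_3$: with $P=\begin{pmatrix}1&0&0\\0&0&1\\0&1&0\end{pmatrix}$ and $Q=\begin{pmatrix}0&1&0\\1&0&0\\0&0&1\end{pmatrix}$, it is defined by $P^{b_1}Q^{b_2}P^{b_3}\cdots Q^{b_{2k}}P^{b_{2k+1}}(1,2,3)^T=(\sigma_D(1),\sigma_D(2),\sigma_D(3))^T$. Permutations are written in cycle notation: $(123)$ is $1\mapsto2\mapsto3\mapsto1$, and $(1)$ is the identity. Graph $G$: the canonical Tait graph, i.e. the graph with vertices the black regions and edges the crossings, for the checkerboard coloring of $D$ with white outside region. It consists of an apex $u$ and vertices $v_1,\ldots,v_{k+1}$, with $b_{2i-1}$ parallel edges joining $u$ and $v_i$ for $1\le i\le k+1$, and a path of $b_{2i}$ edges (with $b_{2i}-1$ new interior vertices) joining $v_i$ to $v_{i+1}$ for $1\le i\le k$. $\chi(G;x,y)$ is its Tutte polynomial (value $x$ on a bridge, $y$ on a loop). The set $E$ and the map $f$: $E=\{b_2,b_4,\ldots,b_{2k}\}$ and $O=\{b_1,b_3,\ldots,b_{2k+1}\}$, where the elements are regarded as labelled by their indices (equal values with different indices are distinct elements). For $A\subseteq E$, $f(A)$ is the collection (counted with multiplicity) of the following numbers. If $A=\emptyset$, the single number $\sum_{b_i\in O}b_i$. If $A\neq\emptyset$: for each pair $b_l,b_m\in A$, $l<m$, with $b_j\notin A$ for all $l<j<m$, the number $\sum_{l\le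 i\le m,\ b_i\in O}b_i$; for the smallest index $m$ with $b_m\in A$, the number $\sum_{1\le i\le m,\ b_i\in O}b_i$; and for the largest index $l$ with $b_l\in A$, the number $\sum_{l\le i\le 2k+1,\ b_i\in O}b_i$. Empty products equal $1$, and quotients such as $\frac{y^\alpha-1}{y-1}$ denote the polynomials $1+y+\cdots+y^{\alpha-1}$. *)

(* Defs.v *)
From HB Require Import structures.
From mathcomp Require Import all_boot all_order all_algebra all_fingroup.

Set Implicit Arguments.
Unset Strict Implicit.
Unset Printing Implicit Defensive.

Import GRing.Theory.

(* A planar diagram in general position with respect to the horizontal
   direction is read from left to right as a word of elementary events.  The
   strands alive at a given abscissa are numbered 0, 1, 2, ... from top to
   bottom, and each of them has a direction: true if it is oriented from left
   to right, false if it is oriented from right to left.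
     Birth i o : two strands joined at their left ends appear at positions i
                 and i+1, with directions o and ~~ o;
     Death i   : the strands at positions i and i+1 are joined at their right
                 ends (so that their directions must be opposite);
     Cross i s : the strands at positions i and i+1 cross; the overcrossing
                 strand runs between bottom left and top right if s = true,
                 and between top left and bottom right if s = false. *)
Inductive event : Type :=
  | Birth of nat & bool
  | Death of nat
  | Cross of nat & bool.

Definition word := seq event.

Section PositionOps.
Variable T : Type.
Implicit Types (s : seq T) (x y : T).
Definition insert2 i x y s := take i s ++ x :: y :: drop i s.
Definition remove2 i s := take i s ++ drop i.+2 s.
Definition swap2 i s :=
  if drop i s is x :: y :: s' then take i s ++ y :: x :: s' else s.
End PositionOps.

Definition step (st : seq bool) (e : event) : option (seq bool) :=
  match e with
  | Birth i o => if i <= size st then Some (insert2 i o (~~ o) st) else None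
  | Death i => if (i.+1 < size st) && (nth false st i != nth false st i.+1)
               then Some (remove2 i st) else None
  | Cross i _ => if i.+1 < size st then Some (swap2 i st) else None
  end.

Fixpoint run (st : seq bool) (w : word) : option (seq bool) :=
  if w is e :: w' then obind (run^~ w') (step st e) else Some st.

Definition link_diagram (w : word) : bool := run [::] w == Some [::].

(* A crossing whose two strands are both directed to the right (or both to the
   left) is of type L_+ iff its overcrossing strand runs between bottom left
   and top right: turning the page so that the strands point upward sends left
   to bottom and bottom to right.  Reversing one strand changes the type. *)
Definition crossing_plus (s d1 d2 : bool) : bool := s == (d1 == d2).

Fixpoint writhe_from (st : seq bool) (w : word) : int :=
  if w is e :: w' then
    let c : int :=
      if e is Cross i s then
        (if crossing_plus s (nth false st i) (nth false st i.+1)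
         then 1 else -1)%R
      else 0%R in
    (c + writhe_from (odflt [::] (step st e)) w')%R
  else 0%R.

Definition writhe (w : word) : int := writhe_from [::] w.

(* Every strand carries the label of its arc.  A death joining two strands
   with the same label closes a component; otherwise it identifies the two
   labels.  [fresh] is larger than all the labels used so far. *)
Fixpoint components_from (fresh : nat) (lab : seq nat) (w : word) : nat :=
  match w with
  | [::] => 0
  | Birth i _ :: w' => components_from fresh.+1 (insert2 i fresh fresh lab) w'
  | Death i :: w' =>
      let a := nth 0 lab i in
      let c := nth 0 lab i.+1 in
      (a == c) + components_from fresh
                   [seq if x == c then a else x | x <- remove2 i lab] w'
  | Cross i _ :: w' => components_from fresh (swap2 i lab) w'
  end.

Definition components (w : word) : nat := components_from 0 [::] w.

Definition arity_in (e : event) : nat := if e is Birth _ _ then 0 else 2.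
Definition arity_out (e : event) : nat := if e is Death _ then 0 else 2.
Definition position (e : event) : nat :=
  match e with Birth i _ => i | Death i => i | Cross i _ => i end.
Definition at_position (i : nat) (e : event) : event :=
  match e with
  | Birth _ o => Birth i o | Death _ => Death i | Cross _ s => Cross i s
  end.

(* The local moves: [MFar], [MZigzag*], [MSlide*] generate the planar isotopies
   (exchange of distant events, cancellation of a maximum with a minimum,
   rotation of a crossing); the others are the Reidemeister moves.  Two words
   are diagrams of isotopic oriented links iff they are related by a sequence
   of such moves performed inside link diagrams. *)
Inductive move : word -> word -> Prop :=
  | MFar e1 e2 k :
      let i := position e1 in
      move [:: e1; at_position (i + arity_out e1 + k) e2]
           [:: at_position (i + arity_in e1 + k) e2; e1]
  | MZigzag1 i o : move [:: Birth i o; Death i.+1] [::]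
  | MZigzag2 i o : move [:: Birth i.+1 o; Death i] [::]
  | MSlideDeath i s :
      move [:: Cross i s; Death i.+1] [:: Cross i.+1 (~~ s); Death i]
  | MSlideBirth i o s :
      move [:: Birth i.+1 o; Cross i s] [:: Birth i o; Cross i.+1 (~~ s)]
  | MReidemeister1 i o s :
      move [:: Birth i.+1 o; Cross i s; Death i.+1] [::]
  | MReidemeister2 i s : move [:: Cross i s; Cross i (~~ s)] [::]
  (* the excluded values a = c <> b are those for which no strand lies above
     the two others *)
  | MReidemeister3 i a b c : (a == b) || (b == c) ->
      move [:: Cross i a; Cross i.+1 b; Cross i c]
           [:: Cross i.+1 c; Cross i b; Cross i.+1 a].

Definition link_invariant (T : Type) (V : word -> T) : Prop :=
  forall u l r v, move l r ->
    link_diagram (u ++ l ++ v) -> link_diagram (u ++ r ++ v) ->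
    V (u ++ l ++ v) = V (u ++ r ++ v).

(* The ring Z[t^(1/4), t^(-1/4)] of Laurent polynomials is considered inside
   its field of fractions. *)
Definition K := {fraction {poly int}}.
Definition t4 : K := tofrac ('X : {poly int})%R. (* t^(1/4) *)
Definition t : K := (t4 ^+ 4)%R.
Definition sqrt_t : K := (t4 ^+ 2)%R.

(* The smoothing of a crossing compatible with the orientations d1 and d2 of
   its strands entering from the left at the top and at the bottom. *)
Definition smoothing (i : nat) (d1 d2 : bool) : word :=
  if d1 == d2 then [::] else [:: Death i; Birth i d2].

Definition skein_relation (V : word -> K) : Prop :=
  forall (u v : word) (i : nat) (st : seq bool),
    run [::] u = Some st -> i.+1 < size st ->
    let d1 := nth false st i in
    let d2 := nth false st i.+1 in
    forall s_plus s_minus : bool,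
      crossing_plus s_plus d1 d2 -> ~~ crossing_plus s_minus d1 d2 ->
    let Lplus := u ++ Cross i s_plus :: v in
    let Lminus := u ++ Cross i s_minus :: v in
    let L0 := u ++ smoothing i d1 d2 ++ v in
    link_diagram Lplus -> link_diagram Lminus -> link_diagram L0 ->
    (t^-1 * V Lminus - t * V Lplus = (sqrt_t - sqrt_t^-1) * V L0)%R.

(* These conditions determine V on nonempty link diagrams; its values on other
   words are irrelevant. *)
Definition is_jones_polynomial (V : word -> K) : Prop :=
  [/\ link_invariant V,
      forall o, V [:: Birth 0 o; Death 0] = 1%R
    & skein_relation V].

(* [:: b_1; ...; b_n] |-> [b_1, ..., b_n]; the last step uses 0^-1 = 0. *)
Fixpoint cfrac (b : seq nat) : rat :=
  if b is x :: b' then (x%:R + (cfrac b')^-1)%R else 0%R.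

Definition canonical_cfrac (b : seq nat) (r : rat) : Prop :=
  [/\ odd (size b), all (fun x => 0 < x) b & cfrac b = r].

(* b_i, with indices starting from 1 *)
Definition term (b : seq nat) (i : nat) : nat := nth 0 b i.-1.

Definition twists (b : seq nat) : word :=
  flatten [seq nseq (term b i) (if odd i then Cross 1 true else Cross 0 false)
          | i <- iota 1 (size b)].

(* At the left end the strand in position 1 goes from right to left, and d4
   is the direction of the strand in position 4. *)
Definition canonical_diagram (b : seq nat) (d4 : bool) : word :=
  [:: Birth 0 false; Birth 2 (~~ d4)] ++ twists b ++ [:: Death 2; Death 0].

Definition canonically_oriented (b : seq nat) (d4 : bool) : Prop :=
  let D := canonical_diagram b d4 in
  link_diagram D /\ (components D = 2 -> d4 = false).

Definition Pmx : 'M[int]_3 := perm_mx (tperm (inord 1) (inord 2)).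
Definition Qmx : 'M[int]_3 := perm_mx (tperm (inord 0) (inord 1)).

Definition is_sigma (b : seq nat) (s : 'S_3) : Prop :=
  ((\prod_(1 <= i < (size b).+1) (if odd i then Pmx else Qmx) ^+ term b i)
     *m (\col_(i < 3) (i.+1)%:R) = \col_(i < 3) ((s i).+1)%:R)%R.

Section Permutations.
Local Open Scope group_scope.
Let p1 : 'I_3 := inord 0.
Let p2 : 'I_3 := inord 1.
Let p3 : 'I_3 := inord 2.
Definition S3_12 : 'S_3 := tperm p1 p2.
Definition S3_13 : 'S_3 := tperm p1 p3.
Definition S3_23 : 'S_3 := tperm p2 p3.
(* (s * s') x = s' (s x), so this is 1 |-> 2 |-> 3 |-> 1. *)
Definition S3_123 : 'S_3 := tperm p1 p2 * tperm p1 p3.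
Definition S3_132 : 'S_3 := S3_123^-1.
End Permutations.

(* (epsilon_1, epsilon_2); the remaining case is s = (13) or (132). *)
Definition eps_init (b : seq nat) (s : 'S_3) : int * int :=
  (if s \in [:: 1%g; S3_23; S3_12; S3_123] then (1, 1)
   else if ~~ odd (term b 1) then (-1, 1) else (-1, -1))%R.

(* (epsilon_(m+1), epsilon_(m+2)) *)
Fixpoint eps_pair (b : seq nat) (s : 'S_3) (m : nat) : int * int :=
  if m is m'.+1 then
    let: (e, e') := eps_pair b s m' in
    let j := m'.+2 in (* e = epsilon_(j-1), e' = epsilon_j *)
    (e', if odd (term b j) &&
            ((~~ odd j && (e' == 1%R)) || (odd j && (e' == (-1)%R)))
         then (- e)%R else e)
  else eps_init b s.

Definition eps (b : seq nat) (s : 'S_3) (i : nat) : int := (eps_pair b s i.-1).1.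

(* Vertices 0, ..., nverts - 1; loops and multiple edges are allowed. *)
Record multigraph := Multigraph {
  nverts : nat;
  edges : seq (nat * nat)
}.

Section Tutte.
Variable G : multigraph.
Implicit Type A : {set 'I_(size (edges G))}.

Definition adjacent A : rel 'I_(nverts G) := fun u v =>
  [exists e in A, (tnth (in_tuple (edges G)) e == (val u, val v))
               || (tnth (in_tuple (edges G)) e == (val v, val u))].

Definition ncomponents A : nat := n_comp (adjacent A) predT.

Definition rank A : nat := nverts G - ncomponents A.

Definition tutte (R : comNzRingType) (x y : R) : R :=
  (\sum_A (x - 1) ^+ (rank setT - rank A) * (y - 1) ^+ (#|A| - rank A))%R.
End Tutte.

(* Between consecutive strands, and above and below all of them, lie gaps,
   numbered 0, 1, 2, ... from top to bottom; gap 0 belongs to the outside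
   region.  With white outside region, the black gaps are those of odd number,
   and the list [gaps] gives the black regions containing gaps 1, 3, 5, ....
   The black regions met so far are numbered from 0 to N - 1, and [E] lists the
   crossings met so far as edges between black regions. *)
Definition merge_label (a c x : nat) : nat :=
  if x == maxn a c then minn a c else unbump (maxn a c) x.

Fixpoint tait_from (N : nat) (gaps : seq nat) (E : seq (nat * nat)) (w : word)
    : multigraph :=
  match w with
  | [::] => Multigraph N E
  | Birth i _ :: w' =>
      let h := i./2 in
      if odd i then
        let a := nth 0 gaps h in
        tait_from N (take h gaps ++ a :: drop h gaps) E w'
      else tait_from N.+1 (take h gaps ++ N :: drop h gaps) E w'
  | Death i :: w' =>
      let h := i./2 in
      if odd i then
        let a := nth 0 gaps h in
        let c := nth 0 gaps h.+1 in
        let gaps' := take h gaps ++ drop h.+1 gaps in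
        if a == c then tait_from N gaps' E w'
        else tait_from N.-1 (map (merge_label a c) gaps')
               [seq (merge_label a c e.1, merge_label a c e.2) | e <- E] w'
      else tait_from N (take h gaps ++ drop h.+1 gaps) E w'
  | Cross i _ :: w' =>
      let h := i./2 in
      if odd i then
        tait_from N gaps (rcons E (nth 0 gaps h, nth 0 gaps h.+1)) w'
      else tait_from N.+1 (set_nth 0 gaps h N) (rcons E (nth 0 gaps h, N)) w'
  end.

Definition tait_graph (w : word) : multigraph := tait_from 0 [::] [::] w.

(* The elements b_i of E and O are represented by their indices i <= n. *)
Definition E_indices (n : nat) : {set 'I_n.+1} := [set i : 'I_n.+1 | (0 < i) && ~~ odd i].

Definition odd_sum (b : seq nat) (l m : nat) : nat :=
  \sum_(l <= i < m.+1 | odd i) term b i.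

Definition f_collection (b : seq nat) (n : nat) (A : {set 'I_n.+1}) : seq nat :=
  if A == set0 then [:: odd_sum b 1 n]
  else
    [seq odd_sum b lm.1 lm.2
       | lm : 'I_n.+1 * 'I_n.+1 <- enum [set lm in setX A A |
                       (lm.1 < lm.2) &&
                       [forall j : 'I_n.+1 in A, ~~ (lm.1 < j < lm.2)]]]
    ++ [seq odd_sum b 1 m | m : 'I_n.+1 <- enum [set m in A | [forall j : 'I_n.+1 in A, m <= j]]]
    ++ [seq odd_sum b l n | l : 'I_n.+1 <- enum [set l in A | [forall j : 'I_n.+1 in A, j <= l]]].

(* (x^m - 1) / (x - 1) *)
Definition geom (R : comNzRingType) (x : R) (m : nat) : R :=
  (\sum_(j < m) x ^+ j)%R.

(* Main.v *)
Require Import Defs.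
From HB Require Import structures.
From mathcomp Require Import all_boot all_order all_algebra all_fingroup.
From mathcomp Require Import ring zify.
Import GRing.Theory.
Local Open Scope ring_scope.

(** The canonical diagram is the plat closure of a word s in two letters: a
    crossing of the two middle strands (letter true) or of the two top strands
    (letter false).  Both sides of the theorem are computed by reading s with the
    same pair of 2 x 2 matrices, so that everything reduces to two-dimensional
    linear algebra.

    Tutte side.  Reading s from left to right, the Tait graph grows by one edge
    per letter: true adds an edge from the current vertex to the apex, false joins
    the current vertex to a new one, which becomes current.  Split the subset sum
    that defines the Tutte polynomial according to whether the chosen edges connect
    the current vertex to the apex (sum P) or not (sum (x - 1) Q).  Adding
    an edge changes (P, Q) into (y P + Q, Q) or (P, P + x Q), starting from
    (0, 1), and the Tutte polynomial is P + (x - 1) Q at the end: this is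
    [tutte_plat].  Iterating the matrices over a block of equal letters and
    recording where P + (x - 1) Q is fed back into Q gives the sum over sets of
    even indices ([total_letters]).

    Jones side.  Fix the part v of the diagram to the right of four strands.  The
    four strands can be closed on the left by two side-by-side arcs, by two nested
    arcs, or by side-by-side arcs followed by one crossing of the middle strands;
    the directions of the strands rule out some of the three.  The Kauffman
    bracket would say that the third value is a combination of the first two.  That
    argument does not apply to V, for which a smoothing that contradicts the
    orientations has no meaning, but its consequence holds: there are gP and gQ such
    that every closure allowed by the directions has the value predicted by gP and
    gQ ([bracket_at]).  This is proved from the right end of the word to the left;
    passing a letter uses the moves and at most one skein relation, and transforms
    (gP, gQ) by the transpose of the matrices above with x = - t, y = - t^-1, times
    minus a power of t^(1/4) that depends on the sign of the crossing
    ([bracket_twist1], [bracket_twist0]).  Multiplying these powers over the word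
    produces the writhe ([jones_plat], [word_factorE]).

    Writhe.  Crossings in one twist region have the same sign, determined by the
    directions of the strands entering it; a region of odd length exchanges two of
    these directions, which gives the recursion for the signs ([twist_sign_rec]).
    The initial signs depend only on the direction d4 of the fourth strand and on
    the parity of the first region.  The permutation sigma sends the left end of a
    strand to its right end; since right ends joined by an arc have opposite
    directions, and by the convention made for links with two components, d4 is true
    exactly when sigma sends the first position to the third
    ([orientation_sigma]). *)

Set Implicit Arguments.
Unset Strict Implicit.
Unset Printing Implicit Defensive.

(** * Weights of a crossing *)

Lemma t4_neq0 : t4 != 0.
Proof. by rewrite /t4 tofrac_eq0 polyX_eq0. Qed.

Lemma t4X4_neq1 : t4 ^+ 4 != 1.
Proof.
rewrite /t4 -tofracXn -tofrac1 tofrac_eq; apply/eqP=> /(congr1 (size : {poly int} -> nat)).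
by rewrite size_polyXn size_poly1.
Qed.

(** Two disjoint circles are the oriented smoothing of a circle with one kink, and
    both kinked circles are unknots: the hypothesis is that instance of the skein
    relation, with s = t^(1/4). *)
Lemma two_circle_value (F : fieldType) (s v : F) : s != 0 -> s ^+ 4 != 1 ->
  (s ^+ 4)^-1 - s ^+ 4 = (s ^+ 2 - (s ^+ 2)^-1) * v -> v = - (s ^+ 2 + (s ^+ 2)^-1).
Proof.
move=> s_neq0 s4_neq1 skein.
have d_neq0 : s ^+ 2 - (s ^+ 2)^-1 != 0.
  rewrite subr_eq0; apply: contra s4_neq1 => /eqP eq_s.
  by rewrite -[4%N]/(2 + 2)%N exprD {1}eq_s mulVf // expf_neq0.
by apply: (mulfI d_neq0); rewrite -skein; field.
Qed.

(** A letter serves at once as the position of the crossing, strands being counted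
    from 0, and as its over/under information: in a canonical diagram the two are
    tied, which is what makes the diagram alternating. *)
Definition xing (c : bool) : event := Cross c c.

Definition sgn (e : bool) : int := if e then 1 else -1.

(** The first argument is the letter, the second tells whether the crossing has
    type L_+.  The power of t^(1/4) combines the contribution of the crossing to
    the normalisation (- A^3) by the writhe, which gives the term 3 * sgn e, with
    the factor that turns the bracket matrix of the crossing into the matrix
    [transfer_step]. *)
Definition twist_factor (c e : bool) : K := - t4 ^ ((if c then 1 else -1) - 3 * sgn e).

Lemma twist_factorE :
  (twist_factor true true = - (t4 ^+ 2)^-1) * (twist_factor true false = - t4 ^+ 4)
  * (twist_factor false true = - (t4 ^+ 4)^-1) * (twist_factor false false = - t4 ^+ 2).
Proof. by []. Qed.

Section SkeinAlgebra.
Variables (F : fieldType) (s : F).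
Hypothesis s_neq0 : s != 0.
Variables (gP gQ W : F).

(** In this lemma and the next three, W is the unknown value of a diagram with two
    equal letters in a row.  Changing one of the two crossings cancels both, and
    smoothing it leaves a diagram whose value is already known; solving the skein
    relation for W gives the value predicted by applying the matrices twice. *)
Lemma skein_twist1_parallel :
  (s ^+ 4)^-1 * gQ - s ^+ 4 * W
    = (s ^+ 2 - (s ^+ 2)^-1) * (- (s ^+ 2)^-1 * (gQ + gP)) ->
  W = - (s ^+ 2)^-1 * (- (s ^+ 2)^-1 * (gQ + gP)
                       + - (s ^+ 2)^-1 * (- (s ^+ 4)^-1 * gP)).
Proof.
move=> skein.
have -> : W = (s ^+ 4)^-1 * ((s ^+ 4)^-1 * gQ - ((s ^+ 4)^-1 * gQ - s ^+ 4 * W)).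
  by field.
by rewrite skein; field.
Qed.

Lemma skein_twist1_antiparallel :
  (s ^+ 4)^-1 * W - s ^+ 4 * gQ = (s ^+ 2 - (s ^+ 2)^-1) * (s ^+ 2 * gP) ->
  W = - s ^+ 4 * (- s ^+ 4 * (gQ + gP) + - s ^+ 4 * (- (s ^+ 4)^-1 * gP)).
Proof.
move=> skein.
have -> : W = s ^+ 4 * (((s ^+ 4)^-1 * W - s ^+ 4 * gQ) + s ^+ 4 * gQ).
  by field.
by rewrite skein; field.
Qed.

Lemma skein_twist0_parallel :
  (s ^+ 4)^-1 * W - s ^+ 4 * (s ^+ 2 * gP)
    = (s ^+ 2 - (s ^+ 2)^-1) * (- s ^+ 4 * (gQ + gP)) ->
  W = - s ^+ 4 * (- s ^+ 2 * (- s ^+ 4 * gQ) + - s ^+ 2 * (gP + gQ)).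
Proof.
move=> skein.
have -> : W = s ^+ 4 * (((s ^+ 4)^-1 * W - s ^+ 4 * (s ^+ 2 * gP))
                        + s ^+ 4 * (s ^+ 2 * gP)) by field.
by rewrite skein; field.
Qed.

Lemma skein_twist0_antiparallel :
  (s ^+ 4)^-1 * (s ^+ 2 * gP) - s ^+ 4 * W = (s ^+ 2 - (s ^+ 2)^-1) * gQ ->
  W = - (s ^+ 2)^-1 * (- (s ^+ 4)^-1 * (- s ^+ 4 * gQ)
                       + - (s ^+ 4)^-1 * (gP + gQ)).
Proof.
move=> skein.
have -> : W = (s ^+ 4)^-1 * ((s ^+ 4)^-1 * (s ^+ 2 * gP)
                - ((s ^+ 4)^-1 * (s ^+ 2 * gP) - s ^+ 4 * W)) by field.
by rewrite skein; field.
Qed.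

Lemma kink_factor_twist1 : s ^+ 2 * gP = s ^+ 2 * (- s ^+ 4 * (- (s ^+ 4)^-1 * gP)).
Proof. by field. Qed.

Lemma kink_factor_twist0 : gQ = - (s ^+ 4)^-1 * (- s ^+ 4 * gQ).
Proof. by field. Qed.

Lemma nest_factor_parallel :
  - s ^+ 4 * (gQ + gP) = s ^+ 2 * (- s ^+ 2 * (gP + gQ)).
Proof. by ring. Qed.

Lemma nest_factor_antiparallel :
  - (s ^+ 2)^-1 * (gQ + gP) = s ^+ 2 * (- (s ^+ 4)^-1 * (gP + gQ)).
Proof. by field. Qed.

Lemma unlink_factor : - (s ^+ 2 + (s ^+ 2)^-1) = (s ^+ 2)^-1 * (- s ^+ 4 - 1).
Proof. by field. Qed.

Lemma twisted_unlink_factor :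
  1 = - (s ^+ 2)^-1 * ((s ^+ 2)^-1 * (- s ^+ 4 - 1) + (s ^+ 2)^-1).
Proof. by field. Qed.

End SkeinAlgebra.

(** * Moves inside a tangle *)

Lemma run_cat st u v : run st (u ++ v) = obind (run^~ v) (run st u).
Proof.
by elim: u st => //= e u IHu st; case: (step st e) => [st'|] //=; rewrite IHu.
Qed.

Section TangleEquivalence.
Variables (V : word -> K) (V_inv : link_invariant V).

(** Two tangles with the incoming strand directions st are identified when they can
    be exchanged inside every diagram without changing V.  Asking for equal outgoing
    directions makes the relation symmetric and stable under composition. *)
Definition tangle_equiv (st : seq bool) (l r : word) : Prop :=
  run st l = run st r /\
  forall u v, run [::] u = Some st -> link_diagram (u ++ l ++ v) ->
    V (u ++ l ++ v) = V (u ++ r ++ v).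

Lemma link_diagram_equiv st u v l r : run [::] u = Some st ->
  run st l = run st r -> link_diagram (u ++ l ++ v) -> link_diagram (u ++ r ++ v).
Proof.
by move=> run_u run_lr; rewrite /link_diagram !(run_cat [::]) run_u /= !run_cat run_lr.
Qed.

Lemma equiv_sym st l r : tangle_equiv st l r -> tangle_equiv st r l.
Proof.
case=> run_lr V_lr; split=> // u v run_u link_r; rewrite V_lr //.
exact: link_diagram_equiv run_u (esym run_lr) link_r.
Qed.

Lemma equiv_trans st l m r :
  tangle_equiv st l m -> tangle_equiv st m r -> tangle_equiv st l r.
Proof.
case=> run_lm V_lm [run_mr V_mr]; split=> [|u v run_u link_l].
  by rewrite run_lm.
by rewrite V_lm // V_mr //; apply: link_diagram_equiv run_u run_lm link_l.
Qed.

(** Invariance is only available between two link diagrams; having the same effect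
    on the directions, l and r occur in link diagrams simultaneously. *)
Lemma equiv_move st l r : move l r -> run st l = run st r -> tangle_equiv st l r.
Proof.
move=> lr run_lr; split=> // u v run_u link_l; apply: V_inv => //.
exact: link_diagram_equiv run_u run_lr link_l.
Qed.

Lemma equiv_catl st l r m : tangle_equiv st l r -> tangle_equiv st (l ++ m) (r ++ m).
Proof.
case=> run_lr V_lr; split=> [|u v run_u]; first by rewrite !run_cat run_lr.
by rewrite -!catA; apply: V_lr.
Qed.

Lemma equiv_catr st st' l r m : run st m = Some st' ->
  tangle_equiv st' l r -> tangle_equiv st (m ++ l) (m ++ r).
Proof.
move=> run_m [run_lr V_lr]; split=> [|u v run_u].
  by rewrite !run_cat run_m.
have run_um : run [::] (u ++ m) = Some st' by rewrite run_cat run_u.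
by move: (V_lr (u ++ m) v run_um); rewrite -!catA.
Qed.

Lemma equiv_in st st' a c l r : run st a = Some st' -> tangle_equiv st' l r ->
  tangle_equiv st (a ++ l ++ c) (a ++ r ++ c).
Proof. by move=> run_a lr; apply: equiv_catr run_a _; apply: equiv_catl. Qed.

Lemma equiv_in_move st st' a c l r : run st a = Some st' -> move l r ->
   run st' l = run st' r -> tangle_equiv st (a ++ l ++ c) (a ++ r ++ c).
Proof. by move=> run_a lr run_lr; apply: equiv_in run_a _; apply: equiv_move. Qed.

Lemma far_cross_birth i s o :
  move [:: Cross i s; Birth i.+2 o] [:: Birth i.+2 o; Cross i s].
Proof. by move: (MFar (Cross i s) (Birth 0 o) 0); rewrite /= !addn0 addn2. Qed.

Lemma far_cross_death i s :
  move [:: Cross i s; Death i.+2] [:: Death i.+2; Cross i s].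
Proof. by move: (MFar (Cross i s) (Death 0) 0); rewrite /= !addn0 addn2. Qed.

Lemma far_death_death i : move [:: Death i; Death i] [:: Death i.+2; Death i].
Proof. by move: (MFar (Death i) (Death 0) 0); rewrite /= !addn0 addn2. Qed.

Lemma far_death_birth i o :
  move [:: Death i; Birth i o] [:: Birth i.+2 o; Death i].
Proof. by move: (MFar (Death i) (Birth 0 o) 0); rewrite /= !addn0 addn2. Qed.

Lemma far_birth_birth i o o' :
  move [:: Birth i o; Birth i.+2 o'] [:: Birth i o'; Birth i o].
Proof. by move: (MFar (Birth i o) (Birth 0 o') 0); rewrite /= !addn0 addn2. Qed.

(** On a variable sequence, [take 0] and [drop 0] do not reduce by computation. *)
Ltac run_simp := rewrite /= /insert2 /swap2 /remove2 /= ?take0 ?drop0 /= ?take0 ?drop0.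

(** The first Reidemeister move is given for a strand that goes straight on, whereas
    here the crossing sits on a maximum.  Inserting a zigzag before the maximum and
    sliding the crossing along it turns the kink into the given form. *)
Lemma kink_death0 a b q s : a != b ->
  tangle_equiv [:: a, b & q] [:: Cross 0 s; Death 0] [:: Death 0].
Proof.
  (* Past the crossing the lower strand has the direction a, which the zigzag must fit. *)
  move=> neq; set o := ~~ a.
  apply: (@equiv_trans _ _ [:: Cross 0 s; Birth 2 o; Death 1; Death 0]).
    apply: equiv_sym.
    apply: (@equiv_in_move _ [:: b, a & q] [:: Cross 0 s] [:: Death 0]
              [:: Birth 2 o; Death 1] [::]) ;
      [by run_simp|exact: (MZigzag2 1 o)|by rewrite /o; case: a {o neq}; run_simp].
  apply: (@equiv_trans _ _ [:: Birth 2 o; Cross 0 s; Death 1; Death 0]).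
    apply: (@equiv_in_move _ _ [::] [:: Death 1; Death 0]
              [:: Cross 0 s; Birth 2 o] [:: Birth 2 o; Cross 0 s]) ;
      [by run_simp|exact: far_cross_birth|by run_simp].
  apply: (@equiv_trans _ _ [:: Birth 2 o; Cross 1 (~~ s); Death 0; Death 0]).
    apply: (@equiv_in_move _ [:: a, b, o, ~~ o & q] [:: Birth 2 o] [:: Death 0]
              [:: Cross 0 s; Death 1] [:: Cross 1 (~~ s); Death 0]) ;
      [by run_simp|exact: MSlideDeath|by rewrite /o; case: a {o neq}; run_simp].
  apply: (@equiv_trans _ _ [:: Birth 2 o; Cross 1 (~~ s); Death 2; Death 0]).
    apply: (@equiv_in_move _ [:: a, o, b, ~~ o & q] [:: Birth 2 o; Cross 1 (~~ s)]
              [::] [:: Death 0; Death 0] [:: Death 2; Death 0]) ;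
      [by run_simp|exact: far_death_death|by rewrite /o; case: a b neq {o} => -[]; run_simp].
  apply: (@equiv_in_move _ _ [::] [:: Death 0]
            [:: Birth 2 o; Cross 1 (~~ s); Death 2] [::]) ;
      [by run_simp|exact: (MReidemeister1 1)|by rewrite /o; case: a b neq {o} => -[]; run_simp].
Qed.

Lemma kink_death1 a b c q s : b != c ->
  tangle_equiv [:: a, b, c & q] [:: Cross 1 s; Death 1] [:: Death 1].
Proof.
  move=> neq; set o := ~~ b.
  apply: (@equiv_trans _ _ [:: Cross 1 s; Birth 3 o; Death 2; Death 1]).
    apply: equiv_sym.
    apply: (@equiv_in_move _ [:: a, c, b & q] [:: Cross 1 s] [:: Death 1]
              [:: Birth 3 o; Death 2] [::]) ;
      [by run_simp|exact: (MZigzag2 2 o)|by rewrite /o; case: b {o neq}; run_simp].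
  apply: (@equiv_trans _ _ [:: Birth 3 o; Cross 1 s; Death 2; Death 1]).
    apply: (@equiv_in_move _ _ [::] [:: Death 2; Death 1]
              [:: Cross 1 s; Birth 3 o] [:: Birth 3 o; Cross 1 s]) ;
      [by run_simp|exact: far_cross_birth|by run_simp].
  apply: (@equiv_trans _ _ [:: Birth 3 o; Cross 2 (~~ s); Death 1; Death 1]).
    apply: (@equiv_in_move _ [:: a, b, c, o, ~~ o & q] [:: Birth 3 o] [:: Death 1]
              [:: Cross 1 s; Death 2] [:: Cross 2 (~~ s); Death 1]) ;
      [by run_simp|exact: MSlideDeath|by rewrite /o; case: b {o neq}; run_simp].
  apply: (@equiv_trans _ _ [:: Birth 3 o; Cross 2 (~~ s); Death 3; Death 1]).
    apply: (@equiv_in_move _ [:: a, b, o, c, ~~ o & q] [:: Birth 3 o; Cross 2 (~~ s)]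
              [::] [:: Death 1; Death 1] [:: Death 3; Death 1]) ;
      [by run_simp|exact: far_death_death|by rewrite /o; case: b c neq {o} => -[]; run_simp].
  apply: (@equiv_in_move _ _ [::] [:: Death 1]
            [:: Birth 3 o; Cross 2 (~~ s); Death 3] [::]) ;
      [by run_simp|exact: (MReidemeister1 2)|by rewrite /o; case: b c neq {o} => -[]; run_simp].
Qed.

(** The mirror image, with respect to a vertical line, of the same argument. *)
Lemma kink_birth0 q o s : tangle_equiv q [:: Birth 0 o; Cross 0 s] [:: Birth 0 (~~ o)].
Proof.
  apply: (@equiv_trans _ _ [:: Birth 0 o; Birth 1 (~~ o); Death 2; Cross 0 s]).
    apply: equiv_sym.
    apply: (@equiv_in_move _ [:: o, ~~ o & q] [:: Birth 0 o] [:: Cross 0 s]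
              [:: Birth 1 (~~ o); Death 2] [::]) ;
      [by run_simp|exact: (MZigzag1 1 (~~ o))|by case: o; run_simp].
  apply: (@equiv_trans _ _ [:: Birth 0 o; Birth 1 (~~ o); Cross 0 s; Death 2]).
    apply: equiv_sym.
    apply: (@equiv_in_move _ [:: o, ~~ o, ~~ ~~ o, ~~ o & q] [:: Birth 0 o; Birth 1 (~~ o)] [::]
              [:: Cross 0 s; Death 2] [:: Death 2; Cross 0 s]) ;
      [by run_simp|exact: far_cross_death|by case: o; run_simp].
  apply: (@equiv_trans _ _ [:: Birth 0 o; Birth 0 (~~ o); Cross 1 (~~ s); Death 2]).
    apply: (@equiv_in_move _ [:: o, ~~ o & q] [:: Birth 0 o] [:: Death 2]
              [:: Birth 1 (~~ o); Cross 0 s] [:: Birth 0 (~~ o); Cross 1 (~~ s)]) ;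
      [by run_simp|exact: MSlideBirth|by case: o; run_simp].
  apply: (@equiv_trans _ _ [:: Birth 0 (~~ o); Birth 2 o; Cross 1 (~~ s); Death 2]).
    apply: equiv_sym.
    apply: (@equiv_in_move _ _ [::] [:: Cross 1 (~~ s); Death 2]
              [:: Birth 0 (~~ o); Birth 2 o] [:: Birth 0 o; Birth 0 (~~ o)]) ;
      [by run_simp|exact: far_birth_birth|by run_simp].
  apply: (@equiv_in_move _ [:: ~~ o, ~~ ~~ o & q] [:: Birth 0 (~~ o)] [::]
            [:: Birth 2 o; Cross 1 (~~ s); Death 2] [::]) ;
      [by run_simp|exact: (MReidemeister1 1)|by case: o; run_simp].
Qed.

Lemma kink_birth1 a q o s :
  tangle_equiv (a :: q) [:: Birth 1 o; Cross 1 s] [:: Birth 1 (~~ o)].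
Proof.
  apply: (@equiv_trans _ _ [:: Birth 1 o; Birth 2 (~~ o); Death 3; Cross 1 s]).
    apply: equiv_sym.
    apply: (@equiv_in_move _ [:: a, o, ~~ o & q] [:: Birth 1 o] [:: Cross 1 s]
              [:: Birth 2 (~~ o); Death 3] [::]) ;
      [by run_simp|exact: (MZigzag1 2 (~~ o))|by case: o; run_simp].
  apply: (@equiv_trans _ _ [:: Birth 1 o; Birth 2 (~~ o); Cross 1 s; Death 3]).
    apply: equiv_sym.
    apply: (@equiv_in_move _ [:: a, o, ~~ o, ~~ ~~ o, ~~ o & q] [:: Birth 1 o; Birth 2 (~~ o)] [::]
              [:: Cross 1 s; Death 3] [:: Death 3; Cross 1 s]) ;
      [by run_simp|exact: far_cross_death|by case: o; run_simp].
  apply: (@equiv_trans _ _ [:: Birth 1 o; Birth 1 (~~ o); Cross 2 (~~ s); Death 3]).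
    apply: (@equiv_in_move _ [:: a, o, ~~ o & q] [:: Birth 1 o] [:: Death 3]
              [:: Birth 2 (~~ o); Cross 1 s] [:: Birth 1 (~~ o); Cross 2 (~~ s)]) ;
      [by run_simp|exact: MSlideBirth|by case: o; run_simp].
  apply: (@equiv_trans _ _ [:: Birth 1 (~~ o); Birth 3 o; Cross 2 (~~ s); Death 3]).
    apply: equiv_sym.
    apply: (@equiv_in_move _ _ [::] [:: Cross 2 (~~ s); Death 3]
              [:: Birth 1 (~~ o); Birth 3 o] [:: Birth 1 o; Birth 1 (~~ o)]) ;
      [by run_simp|exact: far_birth_birth|by run_simp].
  apply: (@equiv_in_move _ [:: a, ~~ o, ~~ ~~ o & q] [:: Birth 1 (~~ o)] [::]
            [:: Birth 3 o; Cross 2 (~~ s); Death 3] [::]) ;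
      [by run_simp|exact: (MReidemeister1 2)|by case: o; run_simp].
Qed.

(** * Skein theory of four strands *)

(** Together with [cap_nest], this spans, modulo the skein relation, the tangles
    with four right ends of alternating directions. *)
Definition cap_vert (a c : bool) : word := [:: Birth 0 a; Birth 2 c].
Definition cap_nest (a b : bool) : word := [:: Birth 0 a; Birth 1 b].
Definition plat_end : word := [:: Death 2; Death 0].

Lemma cap_vert_twist0 a c s :
  tangle_equiv [::] (cap_vert a c ++ [:: Cross 0 s]) (cap_vert (~~ a) c).
Proof.
apply: (@equiv_trans _ _ [:: Birth 0 a; Cross 0 s; Birth 2 c]).
  apply: equiv_sym.
  apply: (@equiv_in_move _ [:: a; ~~ a] [:: Birth 0 a] [::]
            [:: Cross 0 s; Birth 2 c] [:: Birth 2 c; Cross 0 s]);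
    [by []|exact: far_cross_birth|by []].
by apply: (equiv_catl _ (kink_birth0 [::] a s)).
Qed.

Lemma cap_nest_twist1 a b s :
  tangle_equiv [::] (cap_nest a b ++ [:: Cross 1 s]) (cap_nest a (~~ b)).
Proof.
by apply: (@equiv_catr _ [:: a; ~~ a] _ _ [:: Birth 0 a]); last exact: kink_birth1.
Qed.

(** Sliding the crossing along the inner arc moves it from the top strands to the
    middle strands.  Thanks to this, one closure with a crossing is enough for both
    kinds of letters. *)
Lemma cap_nest_twist0 a b s :
  tangle_equiv [::] (cap_nest a b ++ [:: Cross 0 s])
                    (cap_vert b a ++ [:: Cross 1 (~~ s)]).
Proof.
apply: (@equiv_trans _ _ [:: Birth 0 a; Birth 0 b; Cross 1 (~~ s)]).
  apply: (@equiv_in_move _ [:: a; ~~ a] [:: Birth 0 a] [::]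
            [:: Birth 1 b; Cross 0 s] [:: Birth 0 b; Cross 1 (~~ s)]);
    [by []|exact: MSlideBirth|by []].
apply: equiv_sym.
apply: (@equiv_in_move _ [::] [::] [:: Cross 1 (~~ s)]
          [:: Birth 0 b; Birth 2 a] [:: Birth 0 a; Birth 0 b]);
  [by []|exact: far_birth_birth|by []].
Qed.

Lemma cap_vert_smoothing a s o :
  tangle_equiv [::] (cap_vert a a ++ [:: Cross 1 s; Death 1; Birth 1 o])
                    (cap_nest a o).
Proof.
apply: (@equiv_trans _ _ [:: Birth 0 a; Birth 2 a; Death 1; Birth 1 o]).
  apply: (@equiv_in _ [:: a; ~~ a; a; ~~ a] (cap_vert a a) [:: Birth 1 o]
            [:: Cross 1 s; Death 1] [:: Death 1]) => //.
  by apply: kink_death1; case: a.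
apply: (@equiv_in_move _ [:: a; ~~ a] [:: Birth 0 a] [:: Birth 1 o]
          [:: Birth 2 a; Death 1] [::]); [by []|exact: (MZigzag2 1)|by case: a].
Qed.

Lemma cap_nest_smoothing a s o :
  tangle_equiv [::] (cap_nest a (~~ a) ++ [:: Cross 0 s; Death 0; Birth 0 o])
                    (cap_vert o a).
Proof.
apply: (@equiv_trans _ _ [:: Birth 0 a; Birth 1 (~~ a); Death 0; Birth 0 o]).
  apply: (@equiv_in _ [:: a; ~~ a; ~~ ~~ a; ~~ a] (cap_nest a (~~ a)) [:: Birth 0 o]
            [:: Cross 0 s; Death 0] [:: Death 0]) => //.
  by apply: kink_death0; case: a.
apply: (@equiv_trans _ _ [:: Birth 0 a; Birth 0 o]).
  apply: (@equiv_in_move _ [:: a; ~~ a] [:: Birth 0 a] [:: Birth 0 o]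
            [:: Birth 1 (~~ a); Death 0] [::]);
    [by []|exact: (MZigzag2 0)|by case: a].
apply: equiv_sym; apply: equiv_move; [exact: far_birth_birth|by []].
Qed.

Lemma link_diagram_cat st u v :
  run [::] u = Some st -> run st v = Some [::] -> link_diagram (u ++ v).
Proof. by move=> run_u run_v; rewrite /link_diagram run_cat run_u /= run_v. Qed.

Lemma equiv_V st u r v : run [::] u = Some st -> run st v = Some [::] ->
  tangle_equiv [::] u r -> V (u ++ v) = V (r ++ v).
Proof.
move=> run_u run_v [_ /(_ [::] v)]; apply=> //.
exact: link_diagram_cat run_u run_v.
Qed.

Hypothesis V_unknot : forall o, V [:: Birth 0 o; Death 0] = 1.
Hypothesis V_skein : skein_relation V.

(** Written so that the two crossing signs are computed from the directions: the
    sign of a crossing of type L_+ is true exactly when its strands are parallel. *)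
Lemma skein_at u v i st (d1 := nth false st i) (d2 := nth false st i.+1) :
    run [::] u = Some st -> (i.+1 < size st)%N ->
    run (swap2 i st) v = Some [::] ->
    run st (smoothing i d1 d2 ++ v) = Some [::] ->
  t^-1 * V (u ++ Cross i (d1 != d2) :: v) - t * V (u ++ Cross i (d1 == d2) :: v)
    = (sqrt_t - sqrt_t^-1) * V (u ++ smoothing i d1 d2 ++ v).
Proof.
move=> run_u lt_i run_swap run_smooth.
apply: (V_skein run_u) => //.
- exact: eqxx.
- by rewrite /crossing_plus -/d1 -/d2; case: (d1 == d2).
- by apply: link_diagram_cat run_u _; rewrite /= lt_i.
- by apply: link_diagram_cat run_u _; rewrite /= lt_i.
- exact: link_diagram_cat run_u run_smooth.
Qed.

Lemma cap_nest_closure a b : run [::] (cap_nest a b ++ plat_end) = Some [::] ->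
  V (cap_nest a b ++ plat_end) = 1.
Proof.
move=> run_D; rewrite -(V_unknot a).
apply: (V_inv (u := [:: Birth 0 a]) (v := [:: Death 0]) (MZigzag1 1 b)).
  exact/eqP.
by rewrite /link_diagram /=; case: a {run_D}.
Qed.

Lemma cap_vert_twist1_closure a s : V (cap_vert a (~~ a) ++ Cross 1 s :: plat_end) = 1.
Proof.
rewrite -(V_unknot a).
apply: (V_inv (u := [:: Birth 0 a]) (v := [:: Death 0]) (MReidemeister1 1 (~~ a) s));
  by rewrite /link_diagram /=; case: a.
Qed.

Lemma two_circles a c :
  V (cap_vert a c ++ plat_end) = V [:: Birth 0 a; Death 0; Birth 0 c; Death 0].
Proof.
have ->: V (cap_vert a c ++ plat_end) = V (cap_vert a c ++ [:: Death 0; Death 0]).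
  symmetry; apply: (V_inv (u := cap_vert a c) (v := [::]) (far_death_death 0));
    by rewrite /link_diagram /=; case: a c => -[].
symmetry; apply: (V_inv (u := [:: Birth 0 a]) (v := [:: Death 0]) (far_death_birth 0 c));
    by rewrite /link_diagram /=; case: a c => -[].
Qed.

(** A circle may be traversed in either direction: put a kink on it by a move at its
    left end and remove the kink at its right end. *)
Lemma circle_flip o :
  tangle_equiv [::] [:: Birth 0 (~~ o); Death 0] [:: Birth 0 o; Death 0].
Proof.
apply: (@equiv_trans _ _ [:: Birth 0 o; Cross 0 true; Death 0]).
  by apply: equiv_sym; apply: (equiv_catl [:: Death 0] (kink_birth0 [::] o true)).
apply: (@equiv_catr _ [:: o; ~~ o] [:: Cross 0 true; Death 0] [:: Death 0]
          [:: Birth 0 o]); first by [].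
by apply: kink_death0; case: o.
Qed.

Lemma twisted_circle o s : V [:: Birth 0 o; Cross 0 s; Death 0] = 1.
Proof.
rewrite -(V_unknot (~~ o)).
apply: (@equiv_V [:: ~~ o; o] [:: Birth 0 o; Cross 0 s] [:: Birth 0 (~~ o)] [:: Death 0]).
- by [].
- by case: o.
- exact: kink_birth0.
Qed.

(** The skein relation at a kink of a circle only gives two circles with opposite
    directions; reversing one circle covers the other orientations. *)
Lemma unlink_value a c : V (cap_vert a c ++ plat_end) = - (sqrt_t + sqrt_t^-1).
Proof.
have skein_circ o :
    V [:: Birth 0 o; Death 0; Birth 0 (~~ o); Death 0] = - (sqrt_t + sqrt_t^-1).
  have smooth : smoothing 0 (nth false [:: o; ~~ o] 0) (nth false [:: o; ~~ o] 1)
                = [:: Death 0; Birth 0 (~~ o)] by case: o.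
  have run_swap : run (swap2 0 [:: o; ~~ o]) [:: Death 0] = Some [::] by case: (o).
  have := @skein_at [:: Birth 0 o] _ 0 [:: o; ~~ o] erefl isT run_swap.
  rewrite smooth /= !twisted_circle !mulr1 => skein.
  apply: (two_circle_value t4_neq0 t4X4_neq1); apply: skein; by case: (o).
rewrite two_circles; have [->|] := eqVneq c (~~ a); first exact: skein_circ.
move=> c_neq.
have <- : V [:: Birth 0 (~~ a); Death 0; Birth 0 c; Death 0]
        = V [:: Birth 0 a; Death 0; Birth 0 c; Death 0].
  apply: (@equiv_V [::] [:: Birth 0 (~~ a); Death 0] [:: Birth 0 a; Death 0]
            [:: Birth 0 c; Death 0]).
  - by case: a {c_neq}.
  - by case: c {c_neq}.
  - exact: circle_flip.
have -> : c = ~~ ~~ a by case: a c c_neq => -[].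
exact: skein_circ.
Qed.

(** The values of all closures of four strands with directions a, b, c, d that
    continue as v, expressed by two unknowns.  For every choice of two incoming and
    two outgoing strands exactly two of the three closures are allowed, so that gP
    and gQ are determined; which two closures are allowed depends on the directions,
    and this uniform statement avoids choosing a basis for each case.  In terms of
    the graph, gQ stands for the current vertex being separated from the apex and gP
    for the two being connected. *)
Definition bracket_at (a b c d : bool) (v : word) (gP gQ : K) : Prop :=
  [/\ a != b -> c != d -> V (cap_vert a c ++ v) = gQ,
      a != d -> b != c -> V (cap_nest a b ++ v) = t4 ^+ 2 * gP
    & a != c -> b != d ->
        V (cap_vert a b ++ xing true :: v) = twist_factor true (b == c) * (gQ + gP)].

Lemma neq_negb (a b : bool) : a != b -> b = ~~ a.
Proof. by case: a b => -[]. Qed.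

(** Read backwards, the letter acts by the transpose of its matrix.  Side-by-side
    arcs followed by the letter are the third closure for v; on nested arcs the
    letter is a kink; the third closure becomes a double crossing, where the skein
    relation applies. *)
Lemma bracket_twist1 a b c d v gP gQ :
    run [:: a; c; b; d] v = Some [::] -> bracket_at a c b d v gP gQ ->
  bracket_at a b c d (xing true :: v)
    (twist_factor true (b == c) * (- t^-1 * gP)) (twist_factor true (b == c) * (gQ + gP)).
Proof.
move=> run_v [V_vert V_nest V_tw]; split.
- by move=> ab cd; rewrite V_tw // [c == b]eq_sym.
- move=> ad bc; rewrite (negPf bc) twist_factorE.
  have -> : V (cap_nest a b ++ xing true :: v) = V (cap_nest a c ++ v).
    rewrite (neq_negb bc).
    apply: (@equiv_V [:: a; ~~ b; b; d] (cap_nest a b ++ [:: xing true])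
              (cap_nest a (~~ b)) v).
    - by rewrite (neq_negb ad).
    - by rewrite -(neq_negb bc).
    - exact: cap_nest_twist1.
  rewrite V_nest // 1?eq_sym //.
  exact: kink_factor_twist1 t4_neq0 _.
- move=> /neq_negb Ec /neq_negb Ed; subst c d.
  have V_vert' : V (cap_vert a b ++ v) = gQ by apply: V_vert; [case: (a)|case: (b)].
  have R2 : V (cap_vert a b ++ [:: Cross 1 true, Cross 1 false & v]) = gQ.
    rewrite -V_vert'; apply: (@equiv_V [:: a; ~~ a; b; ~~ b]
      (cap_vert a b ++ [:: Cross 1 true; Cross 1 false]) (cap_vert a b) v) => //.
    apply: (@equiv_in_move _ [:: a; ~~ a; b; ~~ b] (cap_vert a b) [::]
             [:: Cross 1 true; Cross 1 false] [::]);
      [by []|exact: MReidemeister2|by []].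
  have run_u : run [::] (cap_vert a b ++ [:: xing true]) = Some [:: a; b; ~~ a; ~~ b].
    by [].
  have := @skein_at _ v 1 _ run_u isT run_v.
  have [Eb|/neq_negb/negb_inj Eb] := eqVneq b (~~ a).
    subst b.
    have V1 : V (cap_vert a (~~ a) ++ xing true :: v) = - (t4 ^+ 2)^-1 * (gQ + gP).
      by rewrite V_tw ?eqxx ?twist_factorE //; case: (a).
    rewrite /= /smoothing eqxx twist_factorE /= => skein.
    apply: (skein_twist1_parallel t4_neq0).
    by rewrite -V1 -R2; apply: skein.
  subst b.
  have V0 : V (cap_vert a a ++ [:: xing true, Death 1, Birth 1 (~~ a) & v]) = t4 ^+ 2 * gP.
    rewrite -V_nest; [|by case: (a)|by case: (a)].
    apply: (@equiv_V [:: a; ~~ a; a; ~~ a]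
              (cap_vert a a ++ [:: xing true; Death 1; Birth 1 (~~ a)])
              (cap_nest a (~~ a)) v).
    - by case: (a).
    - by case: (a) run_v.
    - exact: cap_vert_smoothing.
  rewrite twist_factorE /= /smoothing => skein.
  apply: (skein_twist1_antiparallel t4_neq0).
  rewrite -V0 -R2; move: skein.
  have -> : (a == ~~ a) = false by case: (a).
  by apply; case: (a) run_v.
Qed.

(** The same three cases as for the letter true, with the roles of the side-by-side
    and the nested arcs exchanged by [cap_nest_twist0]. *)
Lemma bracket_twist0 a b c d v gP gQ :
    run [:: b; a; c; d] v = Some [::] -> bracket_at b a c d v gP gQ ->
  bracket_at a b c d (xing false :: v)
    (twist_factor false (a != b) * (gP + gQ)) (twist_factor false (a != b) * (- t * gQ)).
Proof.
move=> run_v [V_vert V_nest V_tw]; split.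
- move=> ab cd; rewrite ab twist_factorE.
  have -> : V (cap_vert a c ++ xing false :: v) = V (cap_vert b c ++ v).
    rewrite (neq_negb ab).
    apply: (@equiv_V [:: ~~ a; a; c; d] (cap_vert a c ++ [:: xing false])
              (cap_vert (~~ a) c) v).
    - by rewrite (neq_negb cd).
    - by rewrite -(neq_negb ab).
    - exact: cap_vert_twist0.
  rewrite V_vert //; last by rewrite eq_sym.
  exact: kink_factor_twist0 t4_neq0 _.
- move=> /neq_negb Ed /neq_negb Ec; subst c d.
  have -> : V (cap_nest a b ++ xing false :: v) = V (cap_vert b a ++ xing true :: v).
    by apply: (@equiv_V [:: b; a; ~~ b; ~~ a] (cap_nest a b ++ [:: xing false])
         (cap_vert b a ++ [:: xing true]) v) => //; exact: cap_nest_twist0.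
  rewrite V_tw; [|by case: (b)|by case: (a)].
  have [Eb|/neq_negb Eb] := eqVneq a b; subst b.
    have -> : (a == ~~ a) = false by case: (a).
    by rewrite !twist_factorE; apply: nest_factor_parallel.
  by rewrite negbK eqxx !twist_factorE; apply: nest_factor_antiparallel t4_neq0 _ _.
- move=> /neq_negb Ec /neq_negb Ed; subst c d.
  have V_nest' : V (cap_nest b a ++ v) = t4 ^+ 2 * gP.
    by apply: V_nest; [case: (b)|case: (a)].
  have to_nest w : run [:: a; b; ~~ a; ~~ b] w = Some [::] ->
      V (cap_vert a b ++ xing true :: w) = V (cap_nest b a ++ xing false :: w).
    move=> run_w; apply: (@equiv_V [:: a; b; ~~ a; ~~ b] (cap_vert a b ++ [:: xing true])
      (cap_nest b a ++ [:: xing false]) w) => //.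
    exact/equiv_sym/cap_nest_twist0.
  have R2 : V (cap_nest b a ++ [:: Cross 0 false, Cross 0 true & v]) = t4 ^+ 2 * gP.
    rewrite -V_nest'; apply: (@equiv_V [:: b; a; ~~ a; ~~ b]
      (cap_nest b a ++ [:: Cross 0 false; Cross 0 true]) (cap_nest b a) v) => //.
    apply: (@equiv_in_move _ [:: b; a; ~~ a; ~~ b] (cap_nest b a) [::]
             [:: Cross 0 false; Cross 0 true] [::]);
      [by []|exact: MReidemeister2|by []].
  rewrite to_nest //.
  have run_u : run [::] (cap_nest b a ++ [:: xing false]) = Some [:: a; b; ~~ a; ~~ b].
    by [].
  have := @skein_at _ v 0 _ run_u isT run_v.
  have [Eb|/neq_negb Eb] := eqVneq a b; subst b.
    have V1 : V (cap_nest a a ++ xing false :: v) = - t4 ^+ 4 * (gQ + gP).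
      rewrite -to_nest // V_tw ?twist_factorE //; [|by case: (a)|by case: (a)].
      by have -> : (a == ~~ a) = false by case: (a).
    have -> : (a == ~~ a) = false by case: (a).
    rewrite /= /smoothing eqxx !twist_factorE /= => skein.
    apply: (skein_twist0_parallel t4_neq0).
    by rewrite -V1 -R2; apply: skein.
  have V0 : V (cap_nest (~~ a) a ++ [:: xing false, Death 0, Birth 0 (~~ a) & v]) = gQ.
    rewrite -[RHS]V_vert; [|by case: (a)|by case: (a)].
    have := @cap_nest_smoothing (~~ a) false (~~ a); rewrite negbK => smooth.
    apply: (@equiv_V [:: ~~ a; a; ~~ a; a] _ _ v _ _ smooth).
    - by case: (a).
    - by case: (a) run_v.
  have -> : (~~ a == ~~ a) by [].
  rewrite /= /smoothing !twist_factorE /= => skein.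
  apply: (skein_twist0_antiparallel t4_neq0).
  rewrite -[in RHS]V0 -R2; move: skein.
  have -> : (a == ~~ a) = false by case: (a).
  by apply; case: (a) run_v.
Qed.

(** The closed diagrams are two circles, a circle, and a circle with a kink. *)
Lemma bracket_plat_end a b c d : run [:: a; b; c; d] plat_end = Some [::] ->
  bracket_at a b c d plat_end (t4 ^+ 2)^-1 ((t4 ^+ 2)^-1 * (- t - 1)).
Proof.
move=> run_end; split.
- by move=> ab cd; rewrite unlink_value; apply: unlink_factor t4_neq0.
- move=> ad bc; rewrite cap_nest_closure ?mulfV ?expf_neq0 ?t4_neq0 //.
  by rewrite -run_end (neq_negb bc) (neq_negb ad).
- move=> /neq_negb Ec /neq_negb Ed; subst c d.
  have Eb : b = ~~ a by move: run_end; case: (a) (b) => -[].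
  subst b; rewrite cap_vert_twist1_closure eqxx twist_factorE.
  exact: twisted_unlink_factor t4_neq0.
Qed.

End TangleEquivalence.

(** * The transfer matrices *)

Section Transfer.
Variable R : comNzRingType.
Implicit Types (x y : R) (pq : R * R).

(** The effect of one more crossing on the pair formed by the subset sums over the
    edge sets that do, respectively do not, connect the current vertex to the apex;
    the second sum is divided by x - 1. *)
Definition transfer_step x y pq (c : bool) : R * R :=
  if c then (y * pq.1 + pq.2, pq.2) else (pq.1, pq.1 + x * pq.2).

Definition transfer x y pq (s : seq bool) : R * R := foldl (transfer_step x y) pq s.

Definition total x pq : R := pq.1 + (x - 1) * pq.2.

Lemma total_transfer_linear x y pq s :
  total x (transfer x y pq s)
    = pq.1 * total x (transfer x y (1, 0) s) + pq.2 * total x (transfer x y (0, 1) s).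
Proof.
have step c s' pq' : transfer x y pq' (c :: s') = transfer x y (transfer_step x y pq' c) s'.
  by [].
elim: s pq => [|c s IHs] pq; first by rewrite /total /=; ring.
rewrite !step (IHs (transfer_step x y pq c)) (IHs (transfer_step x y (1, 0) c)).
rewrite (IHs (transfer_step x y (0, 1) c)).
move: (total x (transfer x y (1, 0) s)) (total x (transfer x y (0, 1) s)) => A B.
by case: c => /=; ring.
Qed.

Lemma transfer_step_true (N f W x y : R) s :
  f * (y * (N * W * total x (transfer x y (1, 0) s)))
    = N * (f * W) * total x (transfer x y (1, 0) (true :: s)) /\
  f * (N * W * total x (transfer x y (0, 1) s)
       + N * W * total x (transfer x y (1, 0) s))
    = N * (f * W) * total x (transfer x y (0, 1) (true :: s)).
Proof.
have step pq c : transfer x y pq (c :: s) = transfer x y (transfer_step x y pq c) s by [].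
rewrite !step (total_transfer_linear _ _ (transfer_step x y (1, 0) _)).
rewrite (total_transfer_linear _ _ (transfer_step x y (0, 1) _)).
move: (total x (transfer x y (1, 0) s)) (total x (transfer x y (0, 1) s)) => A B.
by rewrite /=; split; ring.
Qed.

Lemma transfer_step_false (N f W x y : R) s :
  f * (N * W * total x (transfer x y (1, 0) s)
       + N * W * total x (transfer x y (0, 1) s))
    = N * (f * W) * total x (transfer x y (1, 0) (false :: s)) /\
  f * (x * (N * W * total x (transfer x y (0, 1) s)))
    = N * (f * W) * total x (transfer x y (0, 1) (false :: s)).
Proof.
have step pq c : transfer x y pq (c :: s) = transfer x y (transfer_step x y pq c) s by [].
rewrite !step (total_transfer_linear _ _ (transfer_step x y (1, 0) _)).
rewrite (total_transfer_linear _ _ (transfer_step x y (0, 1) _)).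
move: (total x (transfer x y (1, 0) s)) (total x (transfer x y (0, 1) s)) => A B.
by rewrite /=; split; ring.
Qed.

End Transfer.

(** * The Jones polynomial of a plat *)

Fixpoint word_factor (st s : seq bool) : K :=
  if s is c :: s' then
    twist_factor c (crossing_plus c (nth false st c) (nth false st c.+1))
      * word_factor (swap2 c st) s'
  else 1.

Lemma bracket_word V : is_jones_polynomial V -> forall s a b c d,
    let v := map xing s ++ plat_end in
    let g pq := (t4 ^+ 2)^-1 * word_factor [:: a; b; c; d] s
                * total (- t) (transfer (- t) (- t^-1) pq s) in
    run [:: a; b; c; d] v = Some [::] ->
  bracket_at V a b c d v (g (1, 0)) (g (0, 1)).
Proof.
case=> V_inv V_unknot V_skein; elim=> [|[] s IHs] a b c d v g run_v.
- have := bracket_plat_end V_inv V_unknot V_skein run_v.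
  by rewrite /g /total /= mulr1 mulr0 addr0 add0r !mulr1.
- have := @bracket_twist1 V V_inv V_skein a b c d _ _ _ run_v (IHs a c b d run_v).
  have twist_factorE : crossing_plus true b c = (b == c) by [].
  have [eqP eqQ] := transfer_step_true (t4 ^+ 2)^-1 (twist_factor true (b == c))
     (word_factor [:: a; c; b; d] s) (- t) (- t^-1) s.
  by rewrite eqP eqQ.
- have := @bracket_twist0 V V_inv V_skein a b c d _ _ _ run_v (IHs b a c d run_v).
  have [eqP eqQ] := transfer_step_false (t4 ^+ 2)^-1 (twist_factor false (a != b))
     (word_factor [:: b; a; c; d] s) (- t) (- t^-1) s.
  by rewrite eqP eqQ.
Qed.

(** The left end of the diagram consists of side-by-side arcs, whose value is the
    component gQ. *)
Theorem jones_plat V (d4 : bool) s : is_jones_polynomial V ->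
    link_diagram (cap_vert false (~~ d4) ++ map xing s ++ plat_end) ->
  V (cap_vert false (~~ d4) ++ map xing s ++ plat_end) =
    (t4 ^+ 2)^-1 * word_factor [:: false; true; ~~ d4; d4] s
    * total (- t) (transfer (- t) (- t^-1) (0, 1) s).
Proof.
move=> V_jones /eqP; rewrite run_cat /= => run_v.
have := bracket_word V_jones run_v.
rewrite negbK. by case=> + _ _; apply; case: (d4).
Qed.

Lemma factor_collect (F : fieldType) (z : F) (a : int) (e : bool) (w E E' : int) :
    z != 0 -> E' = a - 3 * sgn e + E ->
  - z ^ (a - 3 * sgn e) * ((-1) ^ w * z ^ E) = (-1) ^ (sgn e + w) * z ^ E'.
Proof.
move=> z_neq0 ->; rewrite !expfzDr ?oppr_eq0 ?oner_eq0 //.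
have -> : (-1) ^ (sgn e) = -1 :> F by case: e; rewrite ?expr1z // exprN1 invrN1.
by ring.
Qed.

(** Each letter contributes a sign, a power of t^(1/4) depending on the letter, and
    the cube of a power depending on the sign of the crossing; as every crossing
    changes the writhe by an odd number, the signs multiply to (-1) ^ w. *)
Lemma word_factorE st s (w := writhe_from st (map xing s ++ plat_end)) :
    run st (map xing s ++ plat_end) = Some [::] ->
  word_factor st s = (-1) ^ w * t4 ^ ((count id s)%:Z - (count negb s)%:Z - 3 * w).
Proof.
rewrite {}/w; elim: s st => [|c s IHs] st run_s; first by rewrite /= !mulr1.
have lt_c : (c.+1 < size st)%N by move: run_s => /=; case: ifP.
have run_s' : run (swap2 c st) (map xing s ++ plat_end) = Some [::].
  by move: run_s; rewrite /= lt_c.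
have -> : writhe_from st (map xing (c :: s) ++ plat_end)
   = sgn (crossing_plus c (nth false st c) (nth false st c.+1))
      + writhe_from (swap2 c st) (map xing s ++ plat_end) by rewrite /= lt_c.
rewrite [LHS]/= (IHs _ run_s') /twist_factor; apply: factor_collect; first exact: t4_neq0.
by case: c {run_s lt_c run_s'} => /=; rewrite !PoszD; ring.
Qed.

(** * Rank of a set of edges *)

Section Components.
Local Open Scope nat_scope.

Implicit Types (F : seq (nat * nat)) (lab : nat -> nat).

(** Union-find: when an edge is processed, the vertices labelled as its second end
    receive the label of its first end.  The labels are natural numbers independent
    of the number of vertices, so that adding a vertex to a graph needs no
    transport between finite types. *)
Definition relabel lab (e : nat * nat) : nat -> nat :=
  fun x => if lab x == lab e.2 then lab e.1 else lab x.

Definition label F : nat -> nat := foldl relabel id F.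

Fixpoint merges_from lab F : nat :=
  if F is e :: F' then (lab e.1 != lab e.2) + merges_from (relabel lab e) F' else 0.

(** The edges that join two different components when processed form a spanning
    forest, so that their number is the rank. *)
Definition merges F : nat := merges_from id F.

Lemma label_rcons F e : label (rcons F e) = relabel (label F) e.
Proof. exact: foldl_rcons. Qed.

Lemma merges_rcons F e :
  merges (rcons F e) = merges F + (label F e.1 != label F e.2).
Proof.
rewrite /merges /label; elim: F id => [|e' F IHF] lab /=; first by rewrite addn0.
by rewrite IHF addnA.
Qed.

Definition edges_below n F : bool := all (fun e => (e.1 < n) && (e.2 < n)) F.

Lemma edges_below_rcons n F e :
  edges_below n (rcons F e) = [&& e.1 < n, e.2 < n & edges_below n F].
Proof. by rewrite /edges_below all_rcons andbA. Qed.

Lemma label_lt n F x : edges_below n F -> x < n -> label F x < n.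
Proof.
elim/last_ind: F x => [|F e IHF] x //.
rewrite edges_below_rcons => /and3P[e1 e2 Fn] ltx.
by rewrite label_rcons /relabel; case: ifP => _; apply: IHF.
Qed.

(** A new vertex is isolated and carries its own number as label. *)
Lemma label_id n F x : edges_below n F -> n <= x -> label F x = x.
Proof.
elim/last_ind: F => [|F e IHF] //.
rewrite edges_below_rcons => /and3P[e1 e2 Fn] lex.
rewrite label_rcons /relabel IHF //; case: eqP => // eq_x.
by have := label_lt Fn e2; rewrite -eq_x ltnNge lex.
Qed.

Definition joined F : rel nat := fun u v => has (fun e => (e == (u, v)) || (e == (v, u))) F.

Lemma joined_sym F : symmetric (joined F).
Proof. by move=> u v; apply: eq_has => e; rewrite orbC. Qed.

Lemma joined_rcons F e u v :
  joined (rcons F e) u v = [|| e == (u, v), e == (v, u) | joined F u v].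
Proof. by rewrite /joined has_rcons orbA. Qed.

Definition graph_rel n F : rel 'I_n := fun u v => joined F u v.

Lemma graph_rel_csym n F : connect_sym (@graph_rel n F).
Proof. by apply: sym_connect_sym => u v; apply: joined_sym. Qed.

(** Applied to the labels, this is the easy half of [connect_label]. *)
Lemma connect_invariant (T : finType) (S : eqType) (e : rel T) (f : T -> S) u v :
  (forall x y, e x y -> f x = f y) -> connect e u v -> f u = f v.
Proof.
move=> ef /connectP[p]; elim: p u => [|x p IHp] u /=; first by move=> _ ->.
by case/andP=> /ef-> /IHp.
Qed.

Lemma joined_label F u v : joined F u v -> label F u = label F v.
Proof.
elim/last_ind: F => [|F e IHF] //; rewrite joined_rcons label_rcons /relabel.
case/or3P=> [/eqP->|/eqP->|/IHF->] //=; first by rewrite eqxx; case: ifP.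
by rewrite eqxx; case: ifP.
Qed.

Lemma connect_label n F (u v : 'I_n) : edges_below n F ->
  connect (@graph_rel n F) u v = (label F u == label F v).
Proof.
move=> Fn; apply/idP/eqP => [|eq_uv].
  by apply: (@connect_invariant _ _ _ (fun x : 'I_n => label F x)) => x y; apply: joined_label.
elim/last_ind: F Fn u v eq_uv => [|F e IHF].
  by move=> _ u v eq_uv; rewrite (val_inj eq_uv) connect0.
rewrite edges_below_rcons => /and3P[e1 e2 Fn] u v.
have sub x y : connect (graph_rel F) x y -> connect (@graph_rel n (rcons F e)) x y.
  apply: connect_sub => {}x {}y xy; apply: connect1.
  by rewrite /graph_rel joined_rcons [joined _ _ _]xy !orbT.
have link : connect (@graph_rel n (rcons F e)) (Ordinal e1) (Ordinal e2).
  by apply: connect1; rewrite /graph_rel joined_rcons -surjective_pairing eqxx.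
rewrite label_rcons /relabel; case: eqP => eq_u; case: eqP => eq_v eq_uv.
- by apply/sub/IHF; rewrite // eq_u.
- apply: connect_trans (sub _ _ (IHF Fn u (Ordinal e2) eq_u)) _.
  rewrite graph_rel_csym in link; apply: connect_trans link _.
  exact/sub/IHF.
- apply: connect_trans (sub _ _ (IHF Fn u (Ordinal e1) eq_uv)) _.
  apply: connect_trans link _; exact/sub/IHF.
- exact/sub/IHF.
Qed.

Definition label_count n F := size (undup (map (label F) (iota 0 n))).

Lemma n_comp_label_count n F : edges_below n F ->
  n_comp (@graph_rel n F) predT = label_count n F.
Proof.
move=> Fn; set e := @graph_rel n F; have csym : connect_sym e := @graph_rel_csym n F.
have lab_root (x : 'I_n) : label F (fingraph.root e x) = label F x.
  by apply/eqP; rewrite -connect_label // csym connect_root.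
rewrite /n_comp_mem (eq_card (B := roots e)) => [|x]; last by rewrite !inE andbT.
rewrite cardE -(size_map (fun x : 'I_n => label F x)); apply/perm_size/uniq_perm.
- rewrite map_inj_in_uniq ?enum_uniq // => x y; rewrite !mem_enum => /eqP rx /eqP ry /eqP eq_xy.
  by rewrite -rx -ry; apply/eqP; rewrite root_connect // connect_label.
- exact: undup_uniq.
move=> y; rewrite mem_undup; apply/mapP/mapP => [[x _ ->]|[x]].
  by exists (val x) => //; rewrite mem_iota /=.
rewrite mem_iota /= add0n => ltx ->; exists (fingraph.root e (Ordinal ltx)).
  by rewrite mem_enum; apply: roots_root.
by rewrite lab_root.
Qed.

(** Every merge makes exactly one label disappear. *)
Lemma label_count_merges n F : edges_below n F -> label_count n F + merges F = n.
Proof.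
elim/last_ind: F => [|F e IHF].
  by rewrite /label_count addn0 map_id undup_id ?iota_uniq // size_iota.
rewrite edges_below_rcons => /and3P[e1 e2 Fn]; rewrite merges_rcons -[RHS]IHF //.
rewrite /label_count label_rcons; set L := map (label F) _.
set la := label F e.1; set lb := label F e.2.
have -> : map (relabel (label F) e) (iota 0 n) = map (fun y => if y == lb then la else y) L.
  by rewrite -map_comp.
have [la_lb|la_lb] /= := eqVneq la lb.
  rewrite addn0 (eq_map (g := id)) ?map_id // => y; rewrite la_lb.
  by case: eqP => [->|].
have La : la \in L by rewrite map_f // mem_iota.
have Lb : lb \in undup L by rewrite mem_undup map_f // mem_iota.
rewrite addnA [_ + _ + 1]addnAC; congr (_ + _).
rewrite addn1 -(prednK (_ : 0 < size (undup L))); last by case: (undup L) Lb.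
rewrite -(size_rem Lb); congr _.+1; apply/perm_size/uniq_perm.
- exact: undup_uniq.
- by rewrite rem_uniq ?undup_uniq.
move=> y; rewrite mem_undup mem_rem_uniq ?undup_uniq // !inE mem_undup.
apply/mapP/andP => [[x Lx ->]|[y_lb Ly]]; last by exists y; rewrite ?(negPf y_lb).
by have [_|x_lb] := eqVneq x lb; split.
Qed.

End Components.

(** * Sums over the subsets of a list of edges *)

Section Sublists.
Variable T : Type.
Implicit Types s : seq T.

Fixpoint sublists s : seq (seq T) :=
  if s is x :: s' then sublists s' ++ map (cons x) (sublists s') else [:: [::]].

Fixpoint masks n : seq bitseq :=
  if n is n'.+1 then map (cons false) (masks n') ++ map (cons true) (masks n')
  else [:: [::]].

Lemma sublists_masks s : sublists s = [seq mask m s | m <- masks (size s)].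
Proof.
elim: s => //= x s IHs; rewrite map_cat -!map_comp IHs; congr (_ ++ _).
by rewrite -map_comp.
Qed.

Lemma mem_masks n m : (m \in masks n) = (size m == n).
Proof.
elim: n m => [|n IHn] m; first by rewrite inE size_eq0.
rewrite mem_cat; case: m => [|b m] /=.
  by apply/norP; split; apply/mapP=> -[].
rewrite eqSS -IHn; apply/orP/idP => [[]/mapP[m' m'n [_ ->]]|mn] //.
by case: b; [right|left]; apply: map_f.
Qed.

Lemma masks_uniq n : uniq (masks n).
Proof.
elim: n => //= n IHn.
rewrite cat_uniq !map_inj_uniq ?IHn ?andbT => [|m m' []//|m m' []//].
by apply/hasPn=> _ /mapP[m _ ->] /=; apply/mapP=> -[m' _].
Qed.

(** Edges are added at the end of the list, while [sublists] recurses on its head. *)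
Lemma sum_sublists_rcons (R : nmodType) (g : seq T -> R) s x :
  \sum_(s' <- sublists (rcons s x)) g s'
    = \sum_(s' <- sublists s) g s' + \sum_(s' <- sublists s) g (rcons s' x).
Proof.
elim: s g => [|y s IHs] g /=; first by rewrite !big_cons !big_nil !addr0.
by rewrite !big_cat !big_map !IHs /= addrACA.
Qed.

(** A set of positions of s is read as a bit mask, and the masks of the right length
    enumerate all the sets exactly once. *)
Lemma sum_sets_sublists (R : nmodType) (g : seq T -> R) s :
  \sum_(A : {set 'I_(size s)}) g [seq tnth (in_tuple s) i | i <- enum A]
    = \sum_(s' <- sublists s) g s'.
Proof.
rewrite sublists_masks big_map.
pose set_of (m : (size s).-tuple bool) := [set i | tnth m i].
rewrite (reindex set_of) /=; last first.
  exists (fun A : {set _} => [tuple i \in A | i < size s]) => [m _|A _].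
    by apply: eq_from_tnth => i; rewrite tnth_mktuple inE.
  by apply/setP=> i; rewrite inE tnth_mktuple.
have mask_of (m : (size s).-tuple bool) :
    [seq tnth (in_tuple s) i | i <- enum (set_of m)] = mask m s.
  have -> : enum (set_of m) = mask m (enum 'I_(size s)).
    rewrite -[in RHS](map_tnth_enum m) -filter_mask enumT /enum_mem -enumT.
    by apply: eq_filter => i; rewrite -[LHS]/(i \in set_of m) inE.
  by rewrite map_mask map_tnth_enum.
under eq_bigr do rewrite mask_of.
rewrite -(big_map val predT (fun m => g (mask m s))); apply: perm_big.
apply: uniq_perm; first by rewrite map_inj_uniq ?index_enum_uniq //; apply: val_inj.
  exact: masks_uniq.
move=> m; rewrite mem_masks; apply/mapP/idP => [[t _ ->]|m_size].
  by rewrite size_tuple.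
by exists (Tuple m_size) => //; rewrite mem_index_enum.
Qed.

End Sublists.

(** * The Tutte polynomial of a plat *)

Lemma sublists_all (T : eqType) (a : pred T) (s s' : seq T) :
  s' \in sublists s -> all a s -> all a s'.
Proof.
rewrite sublists_masks => /mapP[m _ ->] /allP a_s; apply/allP=> x /mem_mask.
exact: a_s.
Qed.

Lemma merges_le_size F : (merges F <= size F)%N.
Proof.
elim/last_ind: F => // F e IHF; rewrite merges_rcons size_rcons -addn1.
by rewrite leq_add // leq_b1.
Qed.

Lemma rank_merges (G : multigraph) (A : {set 'I_(size (edges G))}) :
    edges_below (nverts G) (edges G) ->
  rank A = merges [seq tnth (in_tuple (edges G)) i | i <- enum A].
Proof.
move=> Gn; set F := [seq _ | i <- _].
have Fn : edges_below (nverts G) F.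
  apply/allP=> _ /mapP[i _ ->]; apply: (allP Gn); exact: mem_tnth.
rewrite /rank -[X in (X - _)%N](label_count_merges Fn) -n_comp_label_count //.
rewrite /ncomponents (eq_n_comp (e' := @graph_rel (nverts G) F)) ?addKn //.
apply: eq_connect => u v; rewrite /adjacent /graph_rel /joined has_map.
apply/existsP/hasP => [[i /andP[iA i_uv]]|[i iA i_uv]].
  by exists i; rewrite ?mem_enum.
by exists i; rewrite -mem_enum iA.
Qed.

Section TutteTransfer.
Variables (R : comNzRingType) (x y : R).

Lemma tutte_sublists (G : multigraph) (E := edges G) : edges_below (nverts G) E ->
  tutte G x y = \sum_(F <- sublists E)
    (x - 1) ^+ (merges E - merges F) * (y - 1) ^+ (size F - merges F).
Proof.
move=> Gn; rewrite -sum_sets_sublists; apply: eq_bigr => A _.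
rewrite !rank_merges // size_map -cardE.
suff -> : [seq tnth (in_tuple (edges G)) i | i <- enum [set: 'I_(size (edges G))]] = E by [].
by rewrite enum_setT -[in LHS]enumT map_tnth_enum.
Qed.

(** The apex of a canonical Tait graph is the vertex number 1. *)
Definition linked (cur : nat) F : bool := label F cur == label F 1.

(** The total rank of a connected graph with N vertices is N - 1.  For an edge set
    that does not connect the current vertex to the apex, the rank is at most N - 2,
    and one factor x - 1 is taken out. *)
Definition linked_weight N cur F : R :=
  if linked cur F then (x - 1) ^+ (N.-1 - merges F) * (y - 1) ^+ (size F - merges F)
  else 0.

Definition unlinked_weight N cur F : R :=
  if linked cur F then 0
  else (x - 1) ^+ (N.-2 - merges F) * (y - 1) ^+ (size F - merges F).

(** There is always one label, and there are two when the current vertex is not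
    linked to the apex: this makes the truncated subtractions in the weights
    exact. *)
Lemma merges_linked N cur F : edges_below N F -> (1 < N)%N -> (cur < N)%N ->
  (merges F + ~~ linked cur F < N)%N.
Proof.
move=> Fn N_gt1 lt_cur; rewrite -[X in (_ < X)%N](label_count_merges Fn) addnC ltn_add2r.
have L1 : label F 1 \in undup (map (label F) (iota 0 N)).
  by rewrite mem_undup map_f // mem_iota.
have Lc : label F cur \in undup (map (label F) (iota 0 N)).
  by rewrite mem_undup map_f // mem_iota.
rewrite /label_count /linked; have [_|neq] := eqVneq; first by case: (undup _) L1.
have := @uniq_leq_size _ [:: label F cur; label F 1] (undup (map (label F) (iota 0 N))).
by apply; [rewrite /= inE neq|move=> z; rewrite !inE => /orP[]/eqP->].
Qed.

(** The new edge closes a cycle if its ends are already linked, and lowers the number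
    of components by one otherwise. *)
Lemma weight_step_true N cur F : edges_below N F -> (1 < N)%N -> (cur < N)%N ->
  linked_weight N cur F + linked_weight N cur (rcons F (cur, 1%N))
    = y * linked_weight N cur F + unlinked_weight N cur F
  /\ unlinked_weight N cur F + unlinked_weight N cur (rcons F (cur, 1%N))
    = unlinked_weight N cur F.
Proof.
move=> Fn N_gt1 lt_cur; have := merges_linked Fn N_gt1 lt_cur.
have := merges_le_size F.
have lnk : linked cur (rcons F (cur, 1%N)).
  by rewrite /linked label_rcons /relabel /= eqxx if_same.
rewrite /linked_weight /unlinked_weight lnk merges_rcons size_rcons /= addr0.
rewrite -/(linked cur F); case: (linked cur F) => /= le_size lt_N; split=> //.
  by rewrite !addn0 subSn // exprS; ring.
rewrite addn1 subSS mulr0 !add0r; congr (_ ^+ _ * _).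
by lia.
Qed.

(** Without the new edge, the new vertex is isolated and not linked to the apex; with
    it, the new vertex is linked exactly when the previous one is. *)
Lemma weight_step_false N cur F : edges_below N F -> (1 < N)%N -> (cur < N)%N ->
  linked_weight N.+1 N F + linked_weight N.+1 N (rcons F (cur, N))
    = linked_weight N cur F
  /\ unlinked_weight N.+1 N F + unlinked_weight N.+1 N (rcons F (cur, N))
    = linked_weight N cur F + x * unlinked_weight N cur F.
Proof.
move=> Fn N_gt1 lt_cur; have := merges_linked Fn N_gt1 lt_cur.
have := merges_le_size F.
have lt1 : label F 1 == N = false by apply/ltn_eqF/label_lt.
have ltc : label F cur == N = false by apply/ltn_eqF/label_lt.
have labN : label F N = N by apply: label_id Fn _.
have unl : linked N F = false by rewrite /linked labN eq_sym.
have lnk : linked N (rcons F (cur, N)) = linked cur F.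
  by rewrite /linked label_rcons /relabel /= labN eqxx lt1.
rewrite /linked_weight /unlinked_weight unl lnk merges_rcons size_rcons /= labN ltc addn1 subSS.
case: (linked cur F) => /= le_size lt_N; split; rewrite ?add0r ?mulr0 ?addr0 //.
- by rewrite -subn1 -!subnDA add1n.
- have -> : (N.-1 - merges F = (N.-2 - merges F).+1)%N by lia.
  have -> : (N.-1 - (merges F).+1 = N.-2 - merges F)%N by lia.
  by rewrite exprS; ring.
Qed.

Definition tait_state N cur E : R * R :=
  (\sum_(F <- sublists E) linked_weight N cur F,
   \sum_(F <- sublists E) unlinked_weight N cur F).

Lemma tait_state_true N cur E : edges_below N E -> (1 < N)%N -> (cur < N)%N ->
  tait_state N cur (rcons E (cur, 1%N)) = transfer_step x y (tait_state N cur E) true.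
Proof.
move=> En N_gt1 lt_cur; rewrite /tait_state /transfer_step !sum_sublists_rcons -!big_split /=.
congr (_, _); rewrite ?big_distrr -?big_split /=;
  apply: eq_big_seq => F /sublists_all/(_ En) Fn.
  by have [] := weight_step_true Fn N_gt1 lt_cur.
by have [] := weight_step_true Fn N_gt1 lt_cur.
Qed.

Lemma tait_state_false N cur E : edges_below N E -> (1 < N)%N -> (cur < N)%N ->
  tait_state N.+1 N (rcons E (cur, N)) = transfer_step x y (tait_state N cur E) false.
Proof.
move=> En N_gt1 lt_cur; rewrite /tait_state /transfer_step !sum_sublists_rcons -!big_split /=.
congr (_, _); rewrite ?big_distrr -?big_split /=;
  apply: eq_big_seq => F /sublists_all/(_ En) Fn.
  by have [] := weight_step_false Fn N_gt1 lt_cur.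
by have [] := weight_step_false Fn N_gt1 lt_cur.
Qed.

(** The hypothesis on [merges E] says that the whole graph has at most two
    components, those of the current vertex and of the apex; a letter true, read or
    still to come, makes it connected, and then its rank is N - 1. *)
Lemma tait_from_transfer s N cur E
    (G := tait_from N [:: cur; 1%N] E (map xing s ++ plat_end)) :
    edges_below N E -> (1 < N)%N -> (cur < N)%N ->
    (merges E + ~~ linked cur E = N.-1)%N -> linked cur E || (true \in s) ->
  tutte G x y = total x (transfer x y (tait_state N cur E) s).
Proof.
rewrite {}/G; elim: s N cur E => [|[] s IHs] N cur E En N_gt1 lt_cur mE lnk.
- rewrite orbF in lnk; rewrite lnk addn0 in mE.
  rewrite tutte_sublists //= mE /total /= big_distrr -big_split /=.
  apply: eq_big_seq => F /sublists_all/(_ En) Fn.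
  have := merges_linked Fn N_gt1 lt_cur.
  rewrite /linked_weight /unlinked_weight; case: (linked cur F) => /= lt_N.
    by rewrite mulr0 addr0.
  have -> : (N.-1 - merges F = (N.-2 - merges F).+1)%N by lia.
  by rewrite add0r exprS mulrA.
- rewrite -[transfer x y _ (true :: s)]
           /(transfer x y (transfer_step x y (tait_state N cur E) true) s).
  rewrite -tait_state_true //; apply: (IHs N cur (rcons E (cur, 1%N))) => //.
  + by rewrite edges_below_rcons lt_cur N_gt1.
  + rewrite merges_rcons /linked label_rcons /relabel /= eqxx if_same eqxx addn0.
    exact: mE.
  + by rewrite /linked label_rcons /relabel /= eqxx if_same eqxx.
- have lt1 : label E 1 == N = false by apply/ltn_eqF/label_lt.
  have ltc : label E cur == N = false by apply/ltn_eqF/label_lt.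
  have labN : label E N = N by apply: label_id En _.
  have lnk' : linked N (rcons E (cur, N)) = linked cur E.
    by rewrite /linked label_rcons /relabel /= labN eqxx lt1.
  rewrite -[transfer x y _ (false :: s)]
           /(transfer x y (transfer_step x y (tait_state N cur E) false) s).
  rewrite -tait_state_false //; apply: (IHs N.+1 N (rcons E (cur, N))) => //.
  + rewrite edges_below_rcons ltnSn ltnS (ltnW lt_cur) /=.
    by apply: sub_all En => e /andP[/ltnW e1 /ltnW e2]; rewrite !ltnS e1 e2.
  + exact: ltnW.
  + by rewrite merges_rcons /= labN ltc lnk' addn1 addSn mE prednK // ltnW.
  + by rewrite lnk'.
Qed.

Theorem tutte_plat d s :
    true \in s ->
  tutte (tait_graph (cap_vert false d ++ map xing s ++ plat_end)) x y
    = total x (transfer x y (0, 1) s).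
Proof.
move=> s_true.
(* Two isolated vertices: the empty edge set has the weight x - 1. *)
have -> : (0, 1) = tait_state 2 0 [::].
  by rewrite /tait_state !big_seq1 /linked_weight /unlinked_weight /= !expr0 mulr1.
by apply: tait_from_transfer; rewrite ?s_true ?orbT.
Qed.

End TutteTransfer.

(** * Sums over sets of even indices *)

Lemma sum_subsetU1 (T : finType) (R : nmodType) (F : {set T} -> R) (i : T) (B : {set T}) :
    i \notin B ->
  \sum_(A : {set T} | A \subset i |: B) F A
    = \sum_(A : {set T} | A \subset B) F A + \sum_(A : {set T} | A \subset B) F (i |: A).
Proof.
move=> iB; rewrite (bigID (fun A : {set T} => i \in A)) /= addrC; congr (_ + _).
  apply: eq_bigl => A; apply/andP/idP => [[AiB iA]|AB].
    by rewrite -(setU1K iB) subsetD1 AiB.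
  by rewrite (subset_trans AB) ?subsetUr //; split=> //; apply: contra iB => /(subsetP AB).
rewrite (reindex_onto (fun A => i |: A) (fun A => A :\ i)) /=; last first.
  by move=> A /andP[_ iA]; rewrite setD1K.
apply: eq_bigl => A; rewrite setU11 andbT.
apply/andP/idP => [[iAB /eqP eqA]|AB].
  by rewrite -eqA -(setU1K iB) setSD.
by rewrite setUS // setU1K //; apply: contra iB => /(subsetP AB).
Qed.

Section Collection.
Variables (n : nat).
Implicit Types (A : {set 'I_n.+1}) (i j l m : 'I_n.+1).

Definition consecutive A : {set 'I_n.+1 * 'I_n.+1} :=
  [set lm in setX A A | (lm.1 < lm.2)%N &&
     [forall j : 'I_n.+1 in A, ~~ (lm.1 < j < lm.2)%N]].
Definition smallest A := [set m in A | [forall j : 'I_n.+1 in A, (m <= j)%N]].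
Definition largest A := [set l in A | [forall j : 'I_n.+1 in A, (j <= l)%N]].

(** Adding an index larger than all of A creates one new pair of neighbours, formed
    with the largest element of A; written with the set [largest A] so that A may be
    empty. *)
Lemma consecutiveU1 A j : (forall i, i \in A -> (i < j)%N) ->
  consecutive (j |: A) = consecutive A :|: [set (l, j) | l in largest A].
Proof.
move=> Aj; apply/setP=> [[l m]]; rewrite !inE /=; apply/idP/idP.
- case/and3P=> /andP[jAl jAm] lm /forall_inP lm_free.
  have free i : i \in A -> ~~ (l < i < m)%N by move=> iA; apply: lm_free; rewrite !inE iA orbT.
  case/predU1P: jAm => [Em|mA]; last first.
    case/predU1P: jAl => [El|lA]; first by have := Aj _ mA; rewrite -El ltnNge ltnW.
    by rewrite lA mA lm; apply/orP; left; apply/forall_inP.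
  subst m; case/predU1P: jAl => [El|lA]; first by rewrite El ltnn in lm.
  apply/orP; right; apply/imsetP; exists l => //; rewrite inE lA /=; apply/forall_inP=> i iA.
  by have := free i iA; rewrite Aj // andbT -leqNgt.
- case/orP=> [/and3P[/andP[lA mA] lm /forall_inP free]|/imsetP[l' l'A [-> ->]]].
    rewrite lA mA lm !orbT; apply/forall_inP=> i; rewrite !inE => /predU1P[->|/free//].
    by rewrite [X in _ && X]ltnNge (ltnW (Aj _ mA)) andbF.
  move: l'A; rewrite inE => /andP[lA /forall_inP lmax].
  rewrite eqxx lA orbT Aj //=; apply/forall_inP=> i; rewrite !inE => /predU1P[->|iA].
    by rewrite ltnn andbF.
  by rewrite ltnNge lmax.
Qed.

Lemma smallestU1 A j : A != set0 -> (forall i, i \in A -> (i < j)%N) ->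
  smallest (j |: A) = smallest A.
Proof.
case/set0Pn=> a aA Aj; apply/setP=> m; rewrite !inE; apply/andP/andP.
- case=> /predU1P[->|mA] /forall_inP mmin.
    by have := mmin a; rewrite !inE aA orbT leqNgt Aj // => /(_ isT).
  by split=> //; apply/forall_inP=> i iA; apply: mmin; rewrite !inE iA orbT.
- case=> mA /forall_inP mmin; rewrite mA orbT; split=> //.
  by apply/forall_inP=> i; rewrite !inE => /predU1P[->|/mmin//]; rewrite ltnW ?Aj.
Qed.

Lemma largestU1 A j : (forall i, i \in A -> (i < j)%N) -> largest (j |: A) = [set j].
Proof.
move=> Aj; apply/setP=> l; rewrite !inE; apply/andP/eqP.
- case=> /predU1P[->//|lA] /forall_inP lmax.
  by have := lmax j; rewrite !inE eqxx leqNgt Aj // => /(_ isT).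
- move=> ->; rewrite eqxx; split=> //.
  by apply/forall_inP=> i; rewrite !inE => /predU1P[->//|/Aj/ltnW].
Qed.

Variables (b : seq nat) (R : comNzRingType) (x y : R).

Definition gap_weight (alpha : nat) : R := geom y alpha + x - 1.

(** The collection f(A) with a variable right end c instead of n, so that sets can be
    built by adding their largest element. *)
Definition collection (c : nat) A : seq nat :=
  if A == set0 then [:: odd_sum b 1 c]
  else
    [seq odd_sum b lm.1 lm.2 | lm : 'I_n.+1 * 'I_n.+1 <- enum (consecutive A)]
    ++ [seq odd_sum b 1 m | m : 'I_n.+1 <- enum (smallest A)]
    ++ [seq odd_sum b l c | l : 'I_n.+1 <- enum (largest A)].

Definition set_weight (c : nat) A : R :=
  (\prod_(i in A) geom x (term b i)) * \prod_(alpha <- collection c A) gap_weight alpha.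

(** The last interval of A, which ends at c, is cut at j into one that ends at j and
    one that starts at j. *)
Lemma collectionU1 c A j : (forall i, i \in A -> (i < j)%N) ->
  \prod_(alpha <- collection c (j |: A)) gap_weight alpha
    = (\prod_(alpha <- collection j A) gap_weight alpha) * gap_weight (odd_sum b j c).
Proof.
move=> Aj.
have nonempty : (j |: A == set0) = false by apply/negbTE/set0Pn; exists j; rewrite setU11.
rewrite /collection nonempty !big_cat !big_map !big_enum /=.
rewrite largestU1 // big_set1.
have [A0|A_neq0] := eqVneq A set0.
  have no_pair : consecutive (j |: A) = set0.
    rewrite consecutiveU1 // A0; apply/setP=> [[l m]]; rewrite !inE /=.
    by apply/imsetP=> -[l']; rewrite !inE.
  have small : smallest (j |: A) = [set j].
    apply/setP=> m; rewrite A0 setU0 !inE; case: eqP => //= ->.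
    by apply/forall_inP=> i; rewrite inE => /eqP->.
  by rewrite no_pair small big_set0 big_set1 big_seq1 mul1r.
have disj : [disjoint consecutive A & [set (l, j) | l in largest A]].
  rewrite -setI_eq0; apply/eqP/setP=> [[l m]]; rewrite in_setI in_set0; apply/negP.
  rewrite inE in_setX => /andP[/andP[/andP[_ mA] _] /imsetP[l' _ [_ Em]]].
  by have := Aj _ mA; rewrite Em ltnn.
rewrite consecutiveU1 // smallestU1 // !big_cat !big_map !big_enum /=.
rewrite (eq_bigl [predU consecutive A & [set (l, j) | l in largest A]]) => [|p]; last first.
  by rewrite in_setU.
rewrite bigU // big_imset /= => [|l l' _ _ []//].
by rewrite !mulrA; congr (_ * _); rewrite mulrAC.
Qed.

Lemma set_weightU1 c A j : (forall i, i \in A -> (i < j)%N) ->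
  set_weight c (j |: A) = set_weight j A * geom x (term b j) * gap_weight (odd_sum b j c).
Proof.
move=> Aj; have jA : j \notin A by apply/negP=> /Aj; rewrite ltnn.
by rewrite /set_weight collectionU1 // big_setU1 //=; ring.
Qed.

Definition below k : {set 'I_n.+1} := [set i : 'I_n.+1 | [&& (0 < i)%N, ~~ odd i & (i < k)%N]].

Definition sum_below k c : R := \sum_(A : {set 'I_n.+1} | A \subset below k) set_weight c A.

(** Sort the sets by their largest element i: what lies below i contributes the same
    sum, closed at i. *)
Lemma sum_below_rec k c : (k <= n.+1)%N ->
  sum_below k c = gap_weight (odd_sum b 1 c)
    + \sum_(1 <= i < k | ~~ odd i)
        sum_below i i * geom x (term b i) * gap_weight (odd_sum b i c).
Proof.
elim: k => [|k IHk] le_k.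
  have below0 : below 0 = set0 by apply/setP=> i; rewrite !inE ltn0 !andbF.
  rewrite big_geq // addr0 /sum_below below0.
  under eq_bigl do rewrite subset0.
  by rewrite big_pred1_eq /set_weight big_set0 mul1r /collection eqxx big_seq1.
case: (posnP k) => [k_0|k_gt0].
  (* The index 0 is even but does not number a region. *)
  have belowE : below k.+1 = below k.
    by apply/setP=> i; rewrite !inE k_0; case: (nat_of_ord i).
  rewrite /sum_below belowE -/(sum_below k c) IHk; last exact: ltnW.
  by rewrite k_0 [in LHS]big_geq // [in RHS]big_geq.
rewrite big_mkcond big_nat_recr //= -big_mkcond addrA -IHk; last exact: ltnW.
case: ifP => [k_even|k_odd]; last first.
  have belowE : below k.+1 = below k.
    apply/setP=> i; rewrite !inE ltnS [(i <= k)%N]leq_eqVlt.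
    by case: eqP => [->|] //; rewrite ?k_odd /= ?andbF.
  by rewrite addr0 /sum_below belowE.
pose j := Ordinal le_k.
have belowE : below k.+1 = j |: below k.
  apply/setP=> i; rewrite !inE ltnS [(i <= k)%N]leq_eqVlt -(inj_eq val_inj) /=.
  by case: eqP => [->|] //=; rewrite ?k_gt0 ?k_even.
rewrite /sum_below belowE sum_subsetU1; last by rewrite !inE ltnn !andbF.
congr (_ + _); rewrite !big_distrl /=; apply: eq_bigr => A Am.
by apply: set_weightU1 => i /(subsetP Am); rewrite !inE => /and3P[].
Qed.

End Collection.

(** * Twist regions *)

Definition letters (b : seq nat) (m : nat) : seq bool :=
  flatten [seq nseq (term b i) (odd i) | i <- iota 1 m].

Lemma lettersS b m : letters b m.+1 = letters b m ++ nseq (term b m.+1) (odd m.+1).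
Proof. by rewrite /letters -[in LHS](addn1 m) iotaD map_cat flatten_cat /= cats0 add1n. Qed.

Lemma twists_letters b : twists b = map xing (letters b (size b)).
Proof.
rewrite /twists /letters map_flatten -map_comp; congr flatten; apply: eq_map => i /=.
by rewrite map_nseq; case: (odd i).
Qed.

Lemma odd_sum_recr b l m : (l <= m.+1)%N ->
  odd_sum b l m.+1 = (odd_sum b l m + (if odd m.+1 then term b m.+1 else 0))%N.
Proof. by move=> le_lm; rewrite /odd_sum big_mkcond big_nat_recr //= -big_mkcond. Qed.

Section Blocks.
Variables (R : comNzRingType) (x y : R).

Lemma geomS (z : R) k : geom z k.+1 = z * geom z k + 1.
Proof.
rewrite /geom big_ord_recl expr0 addrC big_distrr; congr (_ + _).
by apply: eq_bigr => i _; rewrite lift0 exprS.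
Qed.

Lemma geomSr (z : R) k : geom z k.+1 = geom z k + z ^+ k.
Proof. exact: big_ord_recr. Qed.

Lemma geomD (z : R) k l : geom z (k + l) = z ^+ l * geom z k + geom z l.
Proof.
elim: l => [|l IHl]; first by rewrite addn0 /geom big_ord0 mul1r addr0.
by rewrite addnS !geomS IHl exprS; ring.
Qed.

Lemma transfer_block_true p q k :
  transfer x y (p, q) (nseq k true) = (y ^+ k * p + geom y k * q, q).
Proof.
elim: k p => [|k IHk] p; first by rewrite /= /geom big_ord0 expr0 mul1r mul0r addr0.
by rewrite /transfer /= -/(transfer _ _ _ _) IHk geomSr exprSr; congr (_, _); ring.
Qed.

Lemma transfer_block_false p q k :
  transfer x y (p, q) (nseq k false) = (p, q + geom x k * total x (p, q)).
Proof.
elim: k q => [|k IHk] q; first by rewrite /geom big_ord0 /= mul0r addr0.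
rewrite /transfer /= -/(transfer _ _ _ _) IHk geomS /total /=; congr (_, _); ring.
Qed.

Variable b : seq nat.

Definition block_state m : R * R := transfer x y (0, 1) (letters b m).

Definition jump i : R := total x (block_state i.-1) * geom x (term b i).

Lemma block_stateS m :
  block_state m.+1 = transfer x y (block_state m) (nseq (term b m.+1) (odd m.+1)).
Proof. by rewrite /block_state lettersS /transfer foldl_cat. Qed.

(** The amount [jump i] that the even region i adds to the second component stays
    there for ever.  An odd region of length k scales the first component by y ^+ k
    and adds to it geom y k times the second one; as geom y (s + k) is
    y ^+ k * geom y s + geom y k, an amount present since i has produced in the first
    component its multiple by geom y of the total length of the odd regions since i. *)
Lemma block_stateE m :
  (block_state m).1 = geom y (odd_sum b 1 m)
                + \sum_(1 <= i < m.+1 | ~~ odd i) jump i * geom y (odd_sum b i m)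
  /\ (block_state m).2 = 1 + \sum_(1 <= i < m.+1 | ~~ odd i) jump i.
Proof.
elim: m => [|m [IHp IHq]].
  by rewrite /odd_sum !big_geq // /geom big_ord0 !addr0.
have osum i : (1 <= i < m.+1)%N ->
    odd_sum b i m.+1 = (odd_sum b i m + (if odd m.+1 then term b m.+1 else 0))%N.
  by case/andP=> _ lt_im; apply/odd_sum_recr/ltnW.
rewrite !(big_mkcond (fun i => ~~ odd i)) !(big_nat_recr m.+1) // -!big_mkcond.
rewrite block_stateS odd_sum_recr //.
have -> : \sum_(1 <= i < m.+1 | ~~ odd i) jump i * geom y (odd_sum b i m.+1)
    = \sum_(1 <= i < m.+1 | ~~ odd i)
        jump i * geom y (odd_sum b i m + (if odd m.+1 then term b m.+1 else 0)).
  by apply: congr_big_nat => // i /andP[_ /osum->].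
case m_odd: (odd m.+1).
  rewrite [block_state m]surjective_pairing transfer_block_true IHp IHq /= !addr0; split=> //.
  under [X in _ = _ + X]eq_bigr do rewrite geomD mulrDr mulrCA.
  by rewrite big_split -big_distrr -big_distrl geomD /=; ring.
rewrite [block_state m]surjective_pairing transfer_block_false /= addn0.
have -> : odd_sum b m.+1 m.+1 = 0%N by rewrite /odd_sum big_mkcond big_nat1 m_odd.
rewrite [geom y 0]big_ord0 mulr0 addr0; split.
  by rewrite [LHS]IHp; congr (_ + _); apply: eq_bigr => i _; rewrite addn0.
by rewrite addrA -IHq /jump [m.+1.-1]/= -surjective_pairing [in RHS]mulrC.
Qed.

Lemma total_block_state m : total x (block_state m) = gap_weight x y (odd_sum b 1 m)
  + \sum_(1 <= i < m.+1 | ~~ odd i) jump i * gap_weight x y (odd_sum b i m).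
Proof.
have [Ep Eq] := block_stateE m; rewrite /total Ep Eq /gap_weight.
under [in RHS]eq_bigr do rewrite -addrA mulrDr.
by rewrite big_split -big_distrl /=; ring.
Qed.

(** Both sides satisfy the same recursion.  For even m an interval ending at m has the
    same odd terms as one ending at m - 1, hence the shift. *)
Lemma sum_below_block_state n m : (m <= n.+1)%N ->
  sum_below n b x y m m = total x (block_state (if odd m then m else m.-1)).
Proof.
elim/ltn_ind: m => m IHm le_m; rewrite sum_below_rec //.
case: (posnP m) => [->|m_gt0].
  by rewrite /= /total /odd_sum !big_geq //= /gap_weight /geom big_ord0; ring.
have -> : \sum_(1 <= i < m | ~~ odd i)
      sum_below n b x y i i * geom x (term b i) * gap_weight x y (odd_sum b i m)
    = \sum_(1 <= i < m | ~~ odd i) jump i * gap_weight x y (odd_sum b i m).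
  apply: congr_big_nat => // i /and3P[i_even _ lt_im].
  by rewrite IHm // ?(negPf i_even) // (leq_trans (ltnW lt_im)).
case: ifP => m_odd; rewrite total_block_state.
  rewrite [in RHS]big_mkcond big_nat_recr //= -big_mkcond m_odd /= addr0.
  by [].
case: m m_gt0 m_odd {IHm le_m} => // m _ m_odd /=.
have osum i : (0 < i < m.+1)%N -> odd_sum b i m.+1 = odd_sum b i m.
  by case/andP=> _ lt_im; rewrite odd_sum_recr ?m_odd ?addn0 // ltnW.
case: (posnP m) m_odd => [->//|m_gt0 _]; rewrite osum //; congr (_ + _).
by apply: congr_big_nat => // i /andP[_ /osum->].
Qed.

End Blocks.

Theorem total_letters (R : comNzRingType) (x y : R) b n : odd n ->
  total x (transfer x y (0, 1) (letters b n)) =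
    \sum_(A : {set 'I_n.+1} | A \subset E_indices n)
      (\prod_(i in A) geom x (term b i))
      * \prod_(alpha <- f_collection b A) (geom y alpha + x - 1).
Proof.
move=> n_odd; have := @sum_below_block_state R x y b n n (leqnSn n); rewrite n_odd => <-.
rewrite /sum_below (_ : below n n = E_indices n) //; apply/setP=> i; rewrite !inE.
have [lt_i|] := ltnP i n; first by rewrite andbT.
rewrite leq_eqVlt ltnNge -ltnS ltn_ord orbF => /eqP <-.
by rewrite n_odd !andbF.
Qed.

(** * The writhe *)

Definition swaps (T : Type) (q : seq T) (s : seq bool) : seq T :=
  foldl (fun q (c : bool) => swap2 c q) q s.

Lemma size4P (T : Type) (q : seq T) : size q = 4%N -> exists x y z w, q = [:: x; y; z; w].
Proof. by case: q => [|x [|y [|z [|w []]]]] // _; exists x, y, z, w. Qed.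

Lemma size_swap2 (T : Type) (q : seq T) (c : bool) : size q = 4%N -> size (swap2 c q) = 4%N.
Proof. by case/size4P=> [x [y [z [w ->]]]]; case: c. Qed.

Lemma size_swaps (T : Type) (q : seq T) s : size q = 4%N -> size (swaps q s) = 4%N.
Proof. by elim: s q => //= c s IHs q /(size_swap2 c)/IHs. Qed.

Lemma swaps_nseq (T : Type) (q : seq T) (c : bool) k : size q = 4%N ->
  swaps q (nseq k c) = if odd k then swap2 c q else q.
Proof.
move=> q4; elim: k q q4 => //= k IHk q q4; rewrite IHk ?size_swap2 //.
by case: ifP; case/size4P: q4 => [x [y [z [w ->]]]]; case: (c).
Qed.

Lemma run_xing st s v : size st = 4%N -> run st (map xing s ++ v) = run (swaps st s) v.
Proof.
elim: s st => //= c s IHs st st4; rewrite st4 -IHs ?size_swap2 //.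
by case: c.
Qed.

Lemma components_from_xing fresh lab s v :
  components_from fresh lab (map xing s ++ v) = components_from fresh (swaps lab s) v.
Proof. by elim: s lab => //= c s IHs lab. Qed.

Definition block_sign (c : bool) (st : seq bool) : int :=
  sgn (crossing_plus c (nth false st c) (nth false st c.+1)).

(** Exchanging two strands does not change whether they are parallel, so the sign is
    the same all along the region. *)
Lemma writhe_from_block st c k v : size st = 4%N ->
  writhe_from st (map xing (nseq k c) ++ v)
    = block_sign c st * k%:Z + writhe_from (swaps st (nseq k c)) v.
Proof.
elim: k st => [|k IHk] st st4; first by rewrite /= mulr0 add0r.
have sgn_swap : block_sign c (swap2 c st) = block_sign c st.
  case/size4P: st4 => [x [y [z [w ->]]]]; rewrite /block_sign /crossing_plus.
  by case: (c); case: x y z => -[] [].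
have -> : writhe_from st (map xing (nseq k.+1 c) ++ v)
    = block_sign c st + writhe_from (swap2 c st) (map xing (nseq k c) ++ v).
  by rewrite /= st4; case: (c).
rewrite IHk ?size_swap2 // sgn_swap addrA; congr (_ + _).
by rewrite -(addn1 k) PoszD mulrDr mulr1 addrC.
Qed.

Section BlockSigns.
Variables (b : seq nat) (st0 : seq bool).
Hypothesis st0_size : size st0 = 4%N.

Definition dirs m : seq bool := swaps st0 (letters b m).

(** The common sign of the crossings of the i-th twist region. *)
Definition twist_sign i : int := block_sign (odd i) (dirs i.-1).

Lemma size_dirs m : size (dirs m) = 4%N.
Proof. exact: size_swaps. Qed.

Lemma dirsS m : dirs m.+1 =
  if odd (term b m.+1) then swap2 (odd m.+1) (dirs m) else dirs m.
Proof.
by rewrite /dirs lettersS /swaps foldl_cat -/(swaps _ _) -/(swaps _ _) swaps_nseq ?size_dirs.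
Qed.

Lemma writhe_from_letters m v :
  writhe_from st0 (map xing (letters b m) ++ v)
    = \sum_(1 <= i < m.+1) twist_sign i * (term b i)%:Z + writhe_from (dirs m) v.
Proof.
elim: m v => [|m IHm] v; first by rewrite big_geq // add0r.
rewrite lettersS map_cat -catA IHm writhe_from_block ?size_dirs //.
rewrite [in RHS]big_nat_recr // addrA; congr (_ + writhe_from _ v).
by rewrite /dirs lettersS [in RHS]/swaps foldl_cat.
Qed.

(** Crossings of one region leave its own pair of strands parallel or antiparallel;
    the region in between modifies the pair when it exchanges an odd number of times
    two strands of opposite directions.  Such strands give the sign 1 in an even
    region and -1 in an odd one. *)
Lemma twist_sign_rec i : twist_sign i.+3 =
  if odd (term b i.+2) && ((~~ odd i.+2 && (twist_sign i.+2 == 1))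
                           || (odd i.+2 && (twist_sign i.+2 == -1)))
  then - twist_sign i.+1 else twist_sign i.+1.
Proof.
rewrite /twist_sign [i.+3.-1]/= [i.+2.-1]/= [i.+1.-1]/= !dirsS.
have [x [y [z [w ->]]]] := size4P (size_dirs i).
rewrite /=; case: (odd i); case: (odd (term b i.+2)); case: (odd (term b i.+1));
 by rewrite /block_sign /crossing_plus; case: x y z => -[] [].
Qed.

Lemma eps_twist_sign sigma : eps_init b sigma = (twist_sign 1, twist_sign 2) ->
  forall i, (0 < i)%N -> eps b sigma i = twist_sign i.
Proof.
move=> init; suff pair m : eps_pair b sigma m = (twist_sign m.+1, twist_sign m.+2).
  by case=> // i _; rewrite /eps pair.
by elim: m => //= m ->; rewrite twist_sign_rec.
Qed.

End BlockSigns.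

(** * The permutation of the strands *)

Notation pos1 := (inord 0 : 'I_3).
Notation pos2 := (inord 1 : 'I_3).
Notation pos3 := (inord 2 : 'I_3).

Definition letter_perm (c : bool) : 'S_3 := if c then tperm pos2 pos3 else tperm pos1 pos2.

(** Permutations compose from left to right: the first letter acts first, and a strand
    that starts at the position i ends at [word_perm s i]. *)
Definition word_perm (s : seq bool) : 'S_3 := (\prod_(c <- s) letter_perm c)%g.

Lemma val_pos : (pos1 = 0%N :> nat) * (pos2 = 1%N :> nat) * (pos3 = 2%N :> nat).
Proof. by rewrite !inordK. Qed.

Lemma I3P (i : 'I_3) : [\/ i = pos1, i = pos2 | i = pos3].
Proof.
case: i => [[|[|[|//]]] lt_i]; [constructor 1|constructor 2|constructor 3];
  by apply: val_inj; rewrite /= inordK.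
Qed.

Lemma pos_eq : ((pos1 == pos2) = false) * ((pos1 == pos3) = false)
  * ((pos2 == pos1) = false) * ((pos2 == pos3) = false)
  * ((pos3 == pos1) = false) * ((pos3 == pos2) = false).
Proof. by rewrite -!(inj_eq val_inj) /= !val_pos. Qed.

Lemma letter_permE c (i : 'I_3) :
  letter_perm c i = (if i == c :> nat then c.+1
                     else if i == c.+1 :> nat then c : nat else i) :> nat.
Proof.
by case: c; rewrite /letter_perm; case: tpermP => [->|->|/eqP + /eqP];
  rewrite -?(inj_eq val_inj) /= ?val_pos // => /negPf-> /negPf->.
Qed.

Lemma nth_swap2 (T : Type) (x0 : T) q (c : bool) (i : 'I_3) : size q = 4%N ->
  nth x0 (swap2 c q) (letter_perm c i) = nth x0 q i.
Proof.
move=> /size4P[x [y [z [w ->]]]]; rewrite letter_permE.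
by case: (I3P i) => ->; rewrite val_pos; case: c.
Qed.

Lemma nth_swaps (T : Type) (x0 : T) q s (i : 'I_3) : size q = 4%N ->
  nth x0 (swaps q s) (word_perm s i) = nth x0 q i.
Proof.
rewrite /word_perm; elim: s q i => [|c s IHs] q i q4; first by rewrite big_nil perm1.
by rewrite big_cons permM [swaps _ _]/(swaps (swap2 c q) s) IHs ?size_swap2 // nth_swap2.
Qed.

Lemma nth_swaps3 (T : Type) (x0 : T) q s : size q = 4%N ->
  nth x0 (swaps q s) 3 = nth x0 q 3.
Proof.
elim: s q => //= c s IHs q q4; rewrite IHs ?size_swap2 //.
by case/size4P: q4 => [x [y [z [w ->]]]]; case: c.
Qed.

Lemma perm_mx_exp n (s : 'S_n.+1) k : perm_mx s ^+ k = perm_mx (s ^+ k)%g :> 'M[int]_n.+1.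
Proof.
elim: k => [|k IHk]; first by rewrite expg0 perm_mx1.
by rewrite exprS IHk expgS perm_mxM mulmxE.
Qed.

Lemma word_perm_nseq c k : word_perm (nseq k c) = (letter_perm c ^+ k)%g.
Proof.
rewrite /word_perm; elim: k => [|k IHk]; first by rewrite big_nil.
by rewrite big_cons expgS IHk.
Qed.

Lemma prod_mx_word_perm b m :
  \prod_(1 <= i < m.+1) (if odd i then Pmx else Qmx) ^+ term b i
    = perm_mx (word_perm (letters b m)).
Proof.
elim: m => [|m IHm].
  by rewrite big_geq // /word_perm /letters /= big_nil perm_mx1.
rewrite big_nat_recr // [in LHS]IHm lettersS /word_perm big_cat perm_mxM mulmxE.
congr (_ * _); rewrite -/(word_perm _) word_perm_nseq -perm_mx_exp.
by rewrite /Pmx /Qmx /letter_perm; case: (odd m.+1).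
Qed.

(** The matrix of a permutation s maps a column v to the column of the v (s i), and
    products of matrices follow the order of the product of permutations. *)
Lemma is_sigma_word_perm b s : is_sigma b s -> s = word_perm (letters b (size b)).
Proof.
rewrite /is_sigma prod_mx_word_perm -row_permE => eq_col; apply/permP=> i.
have /(congr1 (fun A : 'cV[int]_3 => A i 0)) := eq_col.
rewrite !mxE => /eqP; rewrite Num.Theory.eqr_nat eqSS => /eqP eq_i.
by apply: val_inj.
Qed.

Lemma perm3_eq (s u : 'S_3) : s pos1 = u pos1 -> s pos2 = u pos2 -> s = u.
Proof.
move=> s1 s2; apply/permP=> i; case: (I3P i) => -> //.
have [j eq_j] : exists j, s pos3 = u j by exists ((u^-1)%g (s pos3)); rewrite permKV.
rewrite eq_j; case: (I3P j) eq_j => -> // /eqP; rewrite -?s1 -?s2 (inj_eq perm_inj);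
  by rewrite !pos_eq.
Qed.

Lemma sigma_cases (s : 'S_3) :
  (s \in [:: 1%g; S3_23; S3_12; S3_123]) = (s pos1 != pos3).
Proof.
rewrite !inE; apply/idP/idP => [|s13].
  case/or4P=> /eqP->; rewrite ?perm1 ?pos_eq // /S3_23 /S3_12 /S3_123 ?permM.
  - by rewrite tpermD ?pos_eq.
  - by rewrite tpermL pos_eq.
  - by rewrite tpermL tpermD ?pos_eq.
have neq_s : s pos2 != s pos1 by rewrite (inj_eq perm_inj) pos_eq.
apply/or4P; case: (I3P (s pos1)) s13 neq_s => E1; rewrite E1 ?eqxx // => _.
  case: (I3P (s pos2)) => E2; rewrite E2 ?eqxx // => _.
    by constructor 1; apply/eqP/perm3_eq; rewrite perm1.
  constructor 2; apply/eqP/perm3_eq; rewrite /S3_23 ?tpermL //.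
  by rewrite tpermD ?pos_eq.
case: (I3P (s pos2)) => E2; rewrite E2 ?eqxx // => _.
  by constructor 3; apply/eqP/perm3_eq; rewrite /S3_12 ?tpermL ?tpermR.
constructor 4; apply/eqP/perm3_eq; rewrite /S3_123 permM ?tpermL ?tpermR ?tpermL //.
by rewrite tpermD ?pos_eq.
Qed.

(** * The canonical diagram *)

Definition plat (d4 : bool) (s : seq bool) : word :=
  cap_vert false (~~ d4) ++ map xing s ++ plat_end.

Lemma canonical_diagram_plat b d4 :
  canonical_diagram b d4 = plat d4 (letters b (size b)).
Proof. by rewrite /canonical_diagram twists_letters. Qed.

Definition plat_dirs (d4 : bool) : seq bool := [:: false; true; ~~ d4; d4].

Lemma run_plat_start d4 : run [::] (cap_vert false (~~ d4)) = Some (plat_dirs d4).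
Proof. by case: d4. Qed.

Lemma link_plat d4 s :
  link_diagram (plat d4 s) -> run (plat_dirs d4) (map xing s ++ plat_end) = Some [::].
Proof. by rewrite /link_diagram /plat run_cat run_plat_start => /eqP. Qed.

(** If the third position is fixed, the strands from 1 and 2 close up with each other,
    and so do those from 3 and 4. *)
Lemma plat_components d4 s : word_perm s pos3 = pos3 -> components (plat d4 s) = 2%N.
Proof.
move=> fix3; rewrite /plat.
have -> : components (cap_vert false (~~ d4) ++ map xing s ++ plat_end)
        = components_from 2 [:: 0; 0; 1; 1]%N (map xing s ++ plat_end) by [].
rewrite components_from_xing; set q := swaps _ s.
have q4 : size q = 4%N by apply: size_swaps.
have q_nth i : nth 0%N q (word_perm s i) = nth 0%N [:: 0; 0; 1; 1]%N i by apply: nth_swaps.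
have q3 : nth 0%N q 3 = 1%N by rewrite nth_swaps3.
have q2 : nth 0%N q 2 = 1%N by have := q_nth pos3; rewrite fix3 val_pos.
have q01 i : i != pos3 -> nth 0%N q i = 0%N.
  have := q_nth ((word_perm s)^-1%g i); rewrite permKV => -> i_neq3.
  have : (word_perm s)^-1%g i != pos3.
    by rewrite -(inj_eq (@perm_inj _ (word_perm s))) permKV fix3.
  by case: (I3P ((word_perm s)^-1%g i)) => ->; rewrite ?eqxx // val_pos.
have q0 : nth 0%N q 0 = 0%N by have := q01 pos1; rewrite val_pos pos_eq; apply.
have q1 : nth 0%N q 1 = 0%N by have := q01 pos2; rewrite val_pos pos_eq; apply.
by case/size4P: q4 q0 q1 q2 q3 => [x [y [z [w ->]]]] /= -> -> -> ->.
Qed.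

(** The strand that ends at the third position must be opposite to the fourth one.  It
    starts at the first position, directed to the left, or at the second one, directed
    to the right, or at the third one; in the last case there are two components and
    the convention on orientations decides. *)
Lemma orientation_sigma d4 s : link_diagram (plat d4 s) ->
    (components (plat d4 s) = 2%N -> d4 = false) ->
  (word_perm s pos1 == pos3) = d4.
Proof.
move=> /link_plat run_s comp2; rewrite run_xing // in run_s.
set q := swaps _ s in run_s.
have q_nth i : nth false q (word_perm s i) = nth false (plat_dirs d4) i.
  exact: nth_swaps.
have q3 : nth false q 3 = d4 by rewrite nth_swaps3.
have q23 : nth false q 2 != nth false q 3.
  have : size q = 4%N by apply: size_swaps.
  case/size4P=> [x [y [z [w Eq]]]]; move: run_s; rewrite Eq /=.
  by case: eqP.
pose i := (word_perm s)^-1%g pos3; have s_i : word_perm s i = pos3 by rewrite permKV.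
have q2 : nth false q 2 = nth false (plat_dirs d4) i.
  by rewrite -q_nth s_i val_pos.
rewrite -s_i (inj_eq perm_inj); case: (I3P i) s_i q2 => -> s_i; rewrite val_pos => q2.
- by move: q23; rewrite q2 q3 eqxx; case: (d4).
- by move: q23; rewrite q2 q3 pos_eq; case: (d4).
- by rewrite comp2 ?pos_eq // plat_components.
Qed.

Lemma eps_init_twist_sign b d4 (sigma : 'S_3) : (sigma pos1 == pos3) = d4 ->
  eps_init b sigma = (twist_sign b (plat_dirs d4) 1, twist_sign b (plat_dirs d4) 2).
Proof.
move=> sigma_d4; rewrite /eps_init sigma_cases sigma_d4 /twist_sign dirsS //.
by case: (d4) => //=; case: odd.
Qed.

Lemma count_letters b k :
  count id (letters b k.*2.+1) = (\sum_(1 <= i < k.+2) term b (2 * i - 1))%N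
  /\ count negb (letters b k.*2.+1) = (\sum_(1 <= i < k.+1) term b (2 * i))%N.
Proof.
elim: k => [|k [IHo IHe]].
  by rewrite big_nat1 big_geq // lettersS !count_cat !count_nseq /= mul1n.
rewrite doubleS (lettersS b k.*2.+2) (lettersS b k.*2.+1).
move: (letters b k.*2.+1) IHo IHe => s IHo IHe.
rewrite !count_cat IHo IHe !count_nseq /= odd_double /=.
rewrite !mul0n !mul1n !addn0 [in RHS]big_nat_recr // [RHS in _ /\ _ = RHS]big_nat_recr //=.
by rewrite !mul2n doubleS subn1.
Qed.

Lemma writhe_plat d4 s :
  writhe (plat d4 s) = writhe_from (plat_dirs d4) (map xing s ++ plat_end).
Proof. by rewrite /writhe /plat /= !add0r; case: d4. Qed.

Lemma plat_exponent (F : fieldType) (z w : F) (a b c : int) (T : F) : z != 0 ->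
  (z ^+ 2)^-1 * (w * z ^ (a - b - c)) * T = w * z ^ (a - (2 + b) - c) * T.
Proof.
move=> z_neq0; have -> : a - (2 + b) - c = -2 + (a - b - c) by ring.
have -> : z ^ (-2 + (a - b - c)) = (z ^+ 2)^-1 * z ^ (a - b - c).
  exact: (expfzDr (-2)).
by ring.
Qed.

Theorem theorem4p4 (p q k : nat) (b : seq nat) (d4 : bool) (sigma : 'S_3)
    (V : word -> K) :
  (0 < q)%N -> (q <= p)%N -> coprime p q ->
  canonical_cfrac b (p%:Q / q%:Q) -> size b = k.*2.+1 ->
  canonically_oriented b d4 ->
  is_sigma b sigma ->
  is_jones_polynomial V ->
  let D := canonical_diagram b d4 in
  let G := tait_graph D in
  let n := k.*2.+1 in
  let w := writhe D in
  [/\ V D = (-1) ^ w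
            * t4 ^ ((\sum_(1 <= i < k.+2) term b (2 * i - 1)%N)%:Z
                    - (2 + \sum_(1 <= i < k.+1) term b (2 * i)%N)%:Z - 3 * w)
            * tutte G (- t) (- t^-1),
      forall (R : comNzRingType) (x y : R),
        tutte G x y =
          \sum_(A : {set 'I_n.+1} | A \subset E_indices n)
             (\prod_(i in A) geom x (term b i))
             * \prod_(alpha <- f_collection b A) (geom y alpha + x - 1)
    & w = \sum_(1 <= i < n.+1) eps b sigma i * (term b i)%:Z].
Proof.
move=> _ _ _ [_ b_pos _] size_b oriented sigma_b V_jones.
rewrite canonical_diagram_plat size_b => D G n w.
have [linkD compD] : link_diagram D /\ (components D = 2%N -> d4 = false).
  by move: oriented; rewrite /canonically_oriented canonical_diagram_plat size_b.
have sigmaE : sigma = word_perm (letters b n).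
  by rewrite /n -size_b; apply: is_sigma_word_perm.
have tutteG (R : comNzRingType) (x y : R) :
    tutte G x y = total x (transfer x y (0, 1) (letters b n)).
  apply: tutte_plat; rewrite /letters /= mem_cat mem_nseq.
  by case: (b) b_pos size_b => //= b1 b' /andP[->].
split.
- rewrite tutteG /D /plat jones_plat // word_factorE; last exact: link_plat.
  rewrite -writhe_plat -/D -/w; have [-> ->] := count_letters b k.
  rewrite PoszD; exact: plat_exponent t4_neq0.
- by move=> R x y; rewrite tutteG total_letters //= odd_double.
rewrite /w writhe_plat writhe_from_letters // [writhe_from (dirs _ _ _) _]/= !add0r addr0.
apply: eq_big_nat => i /andP[i_gt0 _]; rewrite (@eps_twist_sign b (plat_dirs d4))//.
by apply: eps_init_twist_sign; rewrite sigmaE; apply: orientation_sigma.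
Qed.
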